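(* Let $\mathscr H$ be a complex Hilbert space of dimension $4$ and let $\mathcal S=(\gamma_1,\gamma_2)$ be a pair of weighted density operators on $\mathscr H$ with $\operatorname{supp}\gamma_1\cap\operatorname{supp}\gamma_2=\{0\}$, $\ker\gamma_1\cap\ker\gamma_2=\{0\}$, $\operatorname{supp}\gamma_1\cap\ker\gamma_2=\{0\}$ and $\ker\gamma_1\cap\operatorname{supp}\gamma_2=\{0\}$. Let $(|s_1\rangle,|s_2\rangle)$ be an orthonormal basis of $\operatorname{supp}\gamma_1$ with $\gamma_1|s_i\rangle=g_{1i}|s_i\rangle$, $g_{11}\ge g_{12}>0$, and write $g_{2i}=\langle s_i|\gamma_2|s_i\rangle$, $g_\mu=g_{\mu1}-g_{\mu2}$ ($\mu=1,2$), $g_{23}=\langle s_1|\gamma_2|s_2\rangle$, where the basis is chosen such that $g_{23}\ge0$, and such that $g_{23}=0$ in the case $g_1=0$. Define a finite list of candidate orthonormal bases $(|\phi\rangle,|\phi^\perp\rangle)$ of $\operatorname{supp}\gamma_1$ as follows. (i) If $g_{23}=0$: $(|s_1\rangle,|s_2\rangle)$ is a candidate if $g_{21}\ge g_{11}$, and $(|s_2\rangle,|s_1\rangle)$ is a candidate if $g_{22}\ge g_{12}$; there are no other candidates. (ii) If $g_{23}\ne0$: the candidates are $$|\phi\rangle=(1+x^2)^{-1/2}(|s_1\rangle+x|s_2\rangle),\qquad |\phi^\perp\rangle=(1+x^2)^{-1/2}(x|s_1\rangle-|s_2\rangle)$$ for those real roots $x\neq0$ of the (non-trivial) polynomial equation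 $$x^2g_1^2\,(x^2g_{21}+g_{22}-2xg_{23})-\bigl(xg_2+(x^2-1)g_{23}\bigr)^2(x^2g_{11}+g_{12})=0$$ that satisfy $x g_1\bigl(xg_2+g_{23}(x^2-1)\bigr)\ge0$ and $\langle\phi|\gamma_2-\gamma_1|\phi\rangle\ge0$. For a candidate put $$r=\sqrt{\frac{\langle\phi^\perp|\gamma_2|\phi^\perp\rangle}{\langle\phi^\perp|\gamma_1|\phi^\perp\rangle}},\qquad |\tilde n\rangle=(\gamma_1+\gamma_2)^{-1}\left(\sqrt r\,\gamma_1+\tfrac1{\sqrt r}\,\gamma_2\right)|\phi^\perp\rangle .$$ Then at most one candidate satisfies $\langle\tilde n|\tilde n\rangle<1$. The optimal USD measurement $(E_1,E_2,E_?)$ of $\mathcal S$ satisfies $\operatorname{rank}E_1=1$ and $\operatorname{rank}E_2=2$ if and only if such a candidate exists, and in this case $E_?=|\tilde n\rangle\langle\tilde n|+|\phi\rangle\langle\phi|$ for this candidate.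
   Context: A weighted density operator is a positive semi-definite operator on $\mathscr H$ (no normalization of the trace is required). For a positive semi-definite operator $\rho$, $\operatorname{supp}\rho=(\ker\rho)^\perp$. A USD (unambiguous state discrimination) measurement of $\mathcal S$ is a triple $\mathcal E=(E_1,E_2,E_?)$ of positive semi-definite operators on $\mathscr H$ with $E_1+E_2+E_?=1$ (identity), $\operatorname{tr}(E_2\gamma_1)=0$ and $\operatorname{tr}(E_1\gamma_2)=0$. Its success probability is $\operatorname{tr}(E_1\gamma_1)+\operatorname{tr}(E_2\gamma_2)$; it is optimal if its success probability is maximal among all USD measurements of $\mathcal S$. For pairs $\mathcal S$ with $\ker\gamma_1\cap\ker\gamma_2=\{0\}$ the optimal USD measurement is unique. Under the stated hypotheses $\gamma_1$ and $\gamma_2$ both have rank $2$ and $\gamma_1+\gamma_2$ is invertible. *)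

(* Defs.v *)
From HB Require Import structures.
From mathcomp Require Import all_boot all_order all_algebra.
From mathcomp Require Import complex.
From mathcomp Require Import boolp classical_sets reals.

Set Implicit Arguments.
Unset Strict Implicit.
Unset Printing Implicit Defensive.

Import Order.TTheory GRing.Theory Num.Theory.

Local Open Scope classical_set_scope.
Local Open Scope ring_scope.
Local Open Scope sesquilinear_scope.

(* Kets are column vectors and operators are square matrices acting on the    *)
(* left of kets, so the kernel below is not the left kernel kermx of mxalgebra. *)
(* Scalars are ordered by the partial order of a numClosedFieldType, in which  *)
(* a <= b implies that b - a is real; every inequality between scalars thus    *)
(* carries the assertion that the difference of its two sides is real.         *)

Section Operators.
Context {C : numClosedFieldType} {n : nat}.
Implicit Types (u v w : 'cV[C]_n) (A : 'M[C]_n).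

(* <u|v>, antilinear in u. *)
Definition braket u v : C := (u^t* *m v) 0 0.

(* <u|A|v> *)
Definition sandwich u A v : C := braket u (A *m v).

(* |u><v| *)
Definition ketbra u v : 'M[C]_n := u *m v^t*.

Definition psd A : Prop :=
  A \is hermsymmx /\ forall v, 0 <= sandwich v A v.

Definition ker A : set 'cV[C]_n := [set v | A *m v = 0].

Definition supp A : set 'cV[C]_n :=
  [set v | forall w, ker A w -> braket w v = 0].

Definition orthonormal_basis2 (V : set 'cV[C]_n) u v : Prop :=
  [/\ braket u u = 1, braket v v = 1, braket u v = 0 &
      V = [set w | exists a b : C, w = a *: u + b *: v]].

Definition is_USD (gam1 gam2 E1 E2 Eq : 'M[C]_n) : Prop :=
  [/\ psd E1, psd E2 & psd Eq] /\
  [/\ E1 + E2 + Eq = 1%:M, \tr (E2 *m gam1) = 0 & \tr (E1 *m gam2) = 0].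

Definition success (gam1 gam2 E1 E2 : 'M[C]_n) : C :=
  \tr (E1 *m gam1) + \tr (E2 *m gam2).

Definition is_optimal_USD (gam1 gam2 E1 E2 Eq : 'M[C]_n) : Prop :=
  is_USD gam1 gam2 E1 E2 Eq /\
  forall F1 F2 Fq, is_USD gam1 gam2 F1 F2 Fq ->
    success gam1 gam2 F1 F2 <= success gam1 gam2 E1 E2.

Definition phi_of (s1 s2 : 'cV[C]_n) (x : C) : 'cV[C]_n :=
  (sqrtC (1 + x ^+ 2))^-1 *: (s1 + x *: s2).

Definition phiperp_of (s1 s2 : 'cV[C]_n) (x : C) : 'cV[C]_n :=
  (sqrtC (1 + x ^+ 2))^-1 *: (x *: s1 - s2).

(* [is_candidate gam1 gam2 g11 g12 s1 s2 phi phip]: the pair (phi, phip) is a  *)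
(* candidate basis; g11 and g12 are the eigenvalues of gam1 at s1 and s2.      *)
Definition is_candidate (gam1 gam2 : 'M[C]_n) (g11 g12 : C)
    (s1 s2 phi phip : 'cV[C]_n) : Prop :=
  let g21 := sandwich s1 gam2 s1 in
  let g22 := sandwich s2 gam2 s2 in
  let g23 := sandwich s1 gam2 s2 in
  let g1 := g11 - g12 in
  let g2 := g21 - g22 in
  (g23 = 0 /\
    ((g11 <= g21 /\ (phi = s1 /\ phip = s2)) \/
     (g12 <= g22 /\ (phi = s2 /\ phip = s1))))
  \/
  (g23 <> 0 /\
    exists x : C,
      [/\ x \is Num.real, x <> 0,
          x ^+ 2 * g1 ^+ 2 * (x ^+ 2 * g21 + g22 - 2 * x * g23)
          - (x * g2 + (x ^+ 2 - 1) * g23) ^+ 2 * (x ^+ 2 * g11 + g12) = 0,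
          0 <= x * g1 * (x * g2 + g23 * (x ^+ 2 - 1)) &
          [/\ 0 <= sandwich (phi_of s1 s2 x) (gam2 - gam1) (phi_of s1 s2 x),
              phi = phi_of s1 s2 x & phip = phiperp_of s1 s2 x]]).

Definition ratio (gam1 gam2 : 'M[C]_n) (phip : 'cV[C]_n) : C :=
  sqrtC (sandwich phip gam2 phip / sandwich phip gam1 phip).

Definition ntilde (gam1 gam2 : 'M[C]_n) (phip : 'cV[C]_n) : 'cV[C]_n :=
  let r := ratio gam1 gam2 phip in
  invmx (gam1 + gam2) *m
    ((sqrtC r *: gam1 + (sqrtC r)^-1 *: gam2) *m phip).

End Operators.

(* Main.v *)
Require Import Defs.
From HB Require Import structures.
From mathcomp Require Import all_boot all_order all_algebra.
From mathcomp Require Import complex ring.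
From mathcomp Require Import boolp classical_sets reals.

Set Implicit Arguments.
Unset Strict Implicit.
Unset Printing Implicit Defensive.

Import Order.TTheory GRing.Theory Num.Theory.

Local Open Scope classical_set_scope.
Local Open Scope ring_scope.
Local Open Scope sesquilinear_scope.

(** Necessity.  The space is the (non-orthogonal) direct sum of ker gam2 and
    ker gam1.  If E_? y = p + q with p in ker gam2 and q in ker gam1, a small
    amount of |p><p| may be moved from E_? to E_1 at the price of a multiple of
    |q><q| moved from E_2 to E_?, provided q lies in the range of E_2.
    Optimality thus gives <p|gam1|p> <= <q|gam2|q>, that is,
    A := E_? (gam2 - gam1) E_? is nonnegative when rank E_2 = 2.  The same move
    with 1 and 2 exchanged gives <phip|A|phip> = 0, where phip is the unit vector
    of supp gam1 along the range of E_1 (as projected to supp gam1).  Hence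
    A phip = 0, and the matrix elements of A in the basis (phi, phip) are exactly
    the conditions defining the candidates.

    Sufficiency.  For a candidate, Z = (W - 1) gam2 (W - 1) with
    W = |phi><phi| + r^-1 |phip><phip| is a dual certificate: the loss of
    success of a measurement F relative to the announced one is tr (Z F_?) plus a
    nonnegative multiple of 1 - <phi|F_?|phi>, and tr (Z F_?) = 0 forces
    F_? = E_?. *)

(** * Positive semi-definite operators *)

Section Adjoint.
Context {C : numClosedFieldType}.

Lemma adjmxM m n p (A : 'M[C]_(m, n)) (B : 'M[C]_(n, p)) :
  (A *m B)^t* = B^t* *m A^t*.
Proof. by rewrite trmx_mul map_mxM. Qed.

Lemma adjmxD m n (A B : 'M[C]_(m, n)) : (A + B)^t* = A^t* + B^t*.
Proof. by rewrite linearD /= map_mxD. Qed.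

Lemma adjmxB m n (A B : 'M[C]_(m, n)) : (A - B)^t* = A^t* - B^t*.
Proof. by rewrite linearB /= map_mxB. Qed.

Lemma adjmxZ m n a (A : 'M[C]_(m, n)) : (a *: A)^t* = a^* *: A^t*.
Proof. by rewrite linearZ /= map_mxZ. Qed.

Lemma adjmx0 m n : (0 : 'M[C]_(m, n))^t* = 0.
Proof. by rewrite trmx0 map_mx0. Qed.

Lemma adjmx1 n : (1%:M : 'M[C]_n)^t* = 1%:M.
Proof. by rewrite trmx1 map_mx1. Qed.

End Adjoint.

Section Braket.
Context {C : numClosedFieldType} {n : nat}.
Implicit Types (u v w x y : 'cV[C]_n) (A B : 'M[C]_n) (a : C).

Lemma braketC u v : braket u v = (braket v u)^*.
Proof. by rewrite /braket -{1}[v]trmxCK -adjmxM !mxE. Qed.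

Lemma braketDr u v w : braket u (v + w) = braket u v + braket u w.
Proof. by rewrite /braket mulmxDr mxE. Qed.
Lemma braketNr u v : braket u (- v) = - braket u v.
Proof. by rewrite /braket mulmxN mxE. Qed.
Lemma braketZr u a v : braket u (a *: v) = a * braket u v.
Proof. by rewrite /braket -scalemxAr mxE. Qed.
Lemma braket0r u : braket u 0 = 0.
Proof. by rewrite /braket mulmx0 mxE. Qed.
Lemma braketDl u v w : braket (u + v) w = braket u w + braket v w.
Proof. by rewrite /braket adjmxD mulmxDl mxE. Qed.
Lemma braketNl u v : braket (- u) v = - braket u v.
Proof. by rewrite /braket linearN /= map_mxN mulNmx mxE. Qed.
Lemma braketZl a u v : braket (a *: u) v = a^* * braket u v.
Proof. by rewrite /braket adjmxZ -scalemxAl mxE. Qed.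
Lemma braket0l v : braket 0 v = 0.
Proof. by rewrite /braket adjmx0 mul0mx mxE. Qed.

Definition braketE := (braketDr, braketNr, braketZr, braket0r,
                       braketDl, braketNl, braketZl, braket0l).

Lemma braket_adj u A v : braket u (A *m v) = braket (A^t* *m u) v.
Proof. by rewrite /braket adjmxM trmxCK mulmxA. Qed.

Lemma sandwichC u A v : A^t* = A -> sandwich u A v = (sandwich v A u)^*.
Proof. by move=> hA; rewrite /sandwich braket_adj hA braketC. Qed.

Lemma braket_sum u : braket u u = \sum_i `|u i 0| ^+ 2.
Proof.
rewrite /braket mxE; apply: eq_bigr => i _.
by rewrite !mxE mulrC normCK.
Qed.

Lemma braket_ge0 u : 0 <= braket u u.
Proof. by rewrite braket_sum sumr_ge0 // => i _; rewrite exprn_ge0. Qed.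

Lemma braket_eq0 u : (braket u u == 0) = (u == 0).
Proof.
apply/eqP/eqP=> [|->]; last exact: braket0l.
rewrite braket_sum => /eqP; rewrite psumr_eq0; last first.
  by move=> i _; rewrite exprn_ge0.
move=> /allP h; apply/colP => i; rewrite mxE.
by have := h i (mem_index_enum i); rewrite expf_eq0 normr_eq0 /= => /eqP.
Qed.

Lemma braket_gt0 u : u != 0 -> 0 < braket u u.
Proof. by move=> h; rewrite lt_def braket_ge0 braket_eq0 h. Qed.

Lemma braket_inj u v : (forall w, braket w u = braket w v) -> u = v.
Proof.
move=> h; apply/eqP; rewrite -subr_eq0 -braket_eq0 braketDr braketNr h subrr.
by [].
Qed.

Lemma ketbra_mul u v w : ketbra u v *m w = braket v w *: u.
Proof.
by rewrite /ketbra /braket -mulmxA {1}[_ *m w]mx11_scalar mul_mx_scalar.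
Qed.

Lemma adjmx_ketbra u v : (ketbra u v)^t* = ketbra v u.
Proof. by rewrite /ketbra adjmxM trmxCK. Qed.

Lemma mul_ketbra A u v : A *m ketbra u v = ketbra (A *m u) v.
Proof. by rewrite /ketbra mulmxA. Qed.

Lemma mxtrace_ketbra u v : \tr (ketbra u v) = braket v u.
Proof. by rewrite /ketbra mxtrace_mulC /mxtrace big_ord1. Qed.

Lemma mxtrace_ketbraM u v A : \tr (ketbra u v *m A) = sandwich v A u.
Proof. by rewrite mxtrace_mulC mul_ketbra mxtrace_ketbra. Qed.

Lemma mulmx_cV_inj A B : (forall x, A *m x = B *m x) -> A = B.
Proof.
move=> h; apply/matrixP=> i j.
have /colP/(_ i) := h (delta_mx j 0).
by rewrite -!colE !mxE.
Qed.

Lemma mulmx_sandwich_inj A B :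
  (forall x y, sandwich x A y = sandwich x B y) -> A = B.
Proof.
by move=> h; apply: mulmx_cV_inj => y; apply: braket_inj => x; apply: h.
Qed.

End Braket.

Section Psd.
Context {C : numClosedFieldType} {n : nat}.
Implicit Types (u v w x y : 'cV[C]_n) (A B : 'M[C]_n) (a : C).

Lemma psd_adj A : psd A -> A^t* = A.
Proof.
by case=> /is_hermitianmxP h _; rewrite [in RHS]h expr0 scale1r.
Qed.

Lemma psd_ge0 A v : psd A -> 0 <= sandwich v A v.
Proof. by case. Qed.

Lemma psdI A : A^t* = A -> (forall v, 0 <= sandwich v A v) -> psd A.
Proof.
move=> hA A_ge0; split=> //.
by apply/is_hermitianmxP; rewrite expr0 scale1r hA.
Qed.

Lemma psd_braket u A v : psd A -> braket u (A *m v) = braket (A *m u) v.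
Proof. by move=> hA; rewrite braket_adj psd_adj. Qed.

Lemma psdD A B : psd A -> psd B -> psd (A + B).
Proof.
move=> hA hB; apply: psdI => [|v]; first by rewrite adjmxD !psd_adj.
by rewrite /sandwich mulmxDl braketDr addr_ge0 ?psd_ge0.
Qed.

Lemma psd1 : psd (1%:M : 'M[C]_n).
Proof.
apply: psdI => [|v]; first by rewrite adjmx1.
by rewrite /sandwich mul1mx braket_ge0.
Qed.

Lemma sandwich_ketbra x u y : sandwich x (ketbra u u) y = (braket u x)^* * braket u y.
Proof. by rewrite /sandwich ketbra_mul braketZr mulrC -braketC. Qed.

Lemma psdZ a A : 0 <= a -> psd A -> psd (a *: A).
Proof.
move=> a_ge0 hA; apply: psdI => [|v].
  by rewrite adjmxZ psd_adj // geC0_conj.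
by rewrite /sandwich -scalemxAl braketZr mulr_ge0 ?psd_ge0.
Qed.

Lemma psd_ketbra u : psd (ketbra u u).
Proof.
apply: psdI => [|v]; first by rewrite adjmx_ketbra.
by rewrite sandwich_ketbra mulrC -normCK exprn_ge0.
Qed.

Lemma psd_congr A B : psd A -> B^t* = B -> psd (B *m A *m B).
Proof.
move=> hA hB; apply: psdI => [|v].
  by rewrite !adjmxM (psd_adj hA) hB mulmxA.
by rewrite /sandwich -!mulmxA braket_adj hB; apply: psd_ge0.
Qed.

(** By the spectral theorem [A] is [P^t* D P] with [P] unitary. The eigenvalues are expectations of
    [A], hence nonnegative, and [B] is [P^t*] times the square root of [D]. *)
Lemma psd_factor A : psd A -> exists B : 'M[C]_n, A = B *m B^t*.
Proof.
move=> hA; have hH : A \is hermsymmx by case: hA.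
have /orthomx_spectralP := hermitian_normalmx hH.
set P := spectralmx A; set d := spectral_diag A => defA.
have uP : P \is unitarymx by exact: spectral_unitarymx.
rewrite invmx_unitary // in defA.
have PP : P *m P^t* = 1%:M by exact/unitarymxP.
have d_ge0 i : 0 <= d 0 i.
  have := psd_ge0 (P^t* *m delta_mx i 0) hA; rewrite /sandwich.
  have -> : A *m (P^t* *m delta_mx i 0) = P^t* *m (diag_mx d *m delta_mx i (0 : 'I_1)).
    by rewrite {1}defA -!mulmxA (mulmxA P) PP mul1mx.
  rewrite braket_adj trmxCK mulmxA PP mul1mx.
  rewrite /braket -colE mxE (bigD1 i) //= big1 => [|j /negPf ji]; last first.
    by rewrite !mxE ji /= conjC0 mul0r.
  by rewrite !mxE !eqxx /= conjC1 mul1r addr0 mulr1n.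
exists (P^t* *m diag_mx (\row_i sqrtC (d 0 i))).
rewrite adjmxM trmxCK {1}defA !mulmxA; congr (_ *m _); rewrite -!mulmxA.
congr (_ *m _); rewrite tr_diag_mx map_diag_mx mulmx_diag; congr diag_mx.
apply/rowP=> i; rewrite !mxE /= geC0_conj ?sqrtC_ge0 //.
by rewrite -expr2 sqrtCK.
Qed.

Lemma psd_eq0 A v : psd A -> sandwich v A v = 0 -> A *m v = 0.
Proof.
move=> /psd_factor[B ->]; rewrite /sandwich -!mulmxA braket_adj => /eqP.
by rewrite braket_eq0 => /eqP ->; rewrite mulmx0.
Qed.

(** Positivity at the vector [<y|A|y> x - <y|A|x> y] gives the claim multiplied by [<y|A|y>]; if
    that factor vanishes, then [A y = 0] and both sides are [0]. *)
Lemma psd_CauchySchwarz A x y : psd A ->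
  `|sandwich x A y| ^+ 2 <= sandwich x A x * sandwich y A y.
Proof.
move=> hA; have ay := psd_ge0 y hA.
have hC : sandwich y A x = (sandwich x A y)^* by apply: sandwichC; exact: psd_adj.
have [y0|y0] := eqVneq (sandwich y A y) 0.
  by rewrite y0 mulr0 /sandwich (psd_eq0 hA y0) braket0r normr0 expr0n.
have ay0 : 0 < sandwich y A y by rewrite lt_def y0.
have := psd_ge0 (sandwich y A y *: x - sandwich y A x *: y) hA.
rewrite /sandwich mulmxBr -!scalemxAr !braketE -!/(sandwich _ _ _) hC conjCK.
rewrite (geC0_conj ay) normCK => h.
rewrite -subr_ge0 -(pmulr_rge0 _ ay0); move: h; congr (0 <= _); ring.
Qed.

(** Once a positive factor is written as [B B^t*], the trace of a product of two positive operators
    becomes this sum of expectations, which settles both its sign and its vanishing. *)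
Lemma mxtrace_congr_sum A B :
  \tr (B^t* *m A *m B) = \sum_i sandwich (col i B) A (col i B).
Proof.
apply: eq_bigr => i _; rewrite /sandwich /braket colE !adjmxM.
have -> : (delta_mx i 0 : 'cV[C]_n)^t* = delta_mx 0 i.
  by rewrite trmx_delta map_delta_mx.
have -> : (B^t* *m A *m B) i i =
    (delta_mx 0 i *m (B^t* *m A *m B) *m delta_mx i 0 : 'M_1) 0 0.
  by rewrite -rowE -colE !mxE.
by rewrite !mulmxA.
Qed.

Lemma psd_mxtraceM_ge0 A B : psd A -> psd B -> 0 <= \tr (A *m B).
Proof.
move=> hA /psd_factor[F ->]; rewrite mulmxA mxtrace_mulC mulmxA mxtrace_congr_sum.
by apply: sumr_ge0 => i _; exact: psd_ge0.
Qed.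

(** All summands [<f|A|f>], with [f] a column of a factor [F] of [B], must vanish, so [A]
    annihilates every column of [F]. *)
Lemma psd_mxtraceM_eq0 A B : psd A -> psd B -> \tr (A *m B) = 0 -> A *m B = 0.
Proof.
move=> hA /psd_factor[F ->]; rewrite mulmxA mxtrace_mulC mulmxA mxtrace_congr_sum.
move/eqP; rewrite psumr_eq0 => [/allP h|i _]; last exact: psd_ge0.
suff -> : A *m F = 0 by rewrite mul0mx.
apply/matrixP=> i j; have /eqP/(psd_eq0 hA) := h j (mem_index_enum j).
by rewrite colE mulmxA -colE => /colP/(_ i); rewrite !mxE.
Qed.

End Psd.

(** * Orthonormal bases of two-dimensional subspaces *)

Section OrthonormalBasis.
Context {C : numClosedFieldType} {n : nat}.
Implicit Types (V : set 'cV[C]_n) (u v w : 'cV[C]_n).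

Lemma orthonormal_basis_mem V u v : orthonormal_basis2 V u v -> V v /\ v != 0.
Proof.
case=> _ v1 _ ->; split; last by rewrite -braket_eq0 v1 oner_neq0.
by exists 0, 1; rewrite scale1r scale0r add0r.
Qed.

Lemma orthonormal_basis_swap V u v :
  orthonormal_basis2 V u v -> orthonormal_basis2 V v u.
Proof.
case=> u1 v1 uv ->; split=> //; first by rewrite braketC uv conjC0.
by apply/seteqP; split=> w /= [a [b ->]]; exists b, a; rewrite addrC.
Qed.

Lemma orthonormal_basis_opp V u v :
  orthonormal_basis2 V u v -> orthonormal_basis2 V (- u) v.
Proof.
case=> u1 v1 uv ->; split=> //; rewrite ?braketNl ?braketNr ?uv ?oppr0 ?opprK //.
by apply/seteqP; split=> w /= [a [b ->]]; exists (- a), b; rewrite scaleNr scalerN ?opprK.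
Qed.

(** The unit vector [(a, b)] parametrizes the second vector of the new basis; the first is the
    vector orthogonal to it, with one choice of phase. *)
Lemma orthonormal_rotate V s1 s2 (a b : C) :
  orthonormal_basis2 V s1 s2 -> a * a^* + b * b^* = 1 ->
  orthonormal_basis2 V (b^* *: s1 - a^* *: s2) (a *: s1 + b *: s2).
Proof.
case=> s11 s22 s12 -> ab1.
have s21 : braket s2 s1 = 0 by rewrite braketC s12 conjC0.
split.
- by rewrite !braketE s11 s22 s12 s21 !conjCK -[RHS]ab1; ring.
- by rewrite !braketE s11 s22 s12 s21 -[RHS]ab1; ring.
- by rewrite !braketE s11 s22 s12 s21 !conjCK; ring.
apply/seteqP; split=> w /= -[c [d ->]].
  (* The coefficients are the inner products of the new basis vectors with [w]. *)
  exists (c * b - d * a), (c * a^* + d * b^*).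
  rewrite scalerBr scalerDr !scalerA addrACA -scalerDl -scaleNr -scalerDl.
  by congr (_ *: _ + _ *: _); rewrite -[LHS]mulr1 -ab1; ring.
exists (c * b^* + d * a), (- c * a^* + d * b).
rewrite scalerBr scalerDr !scalerA addrACA -scalerDl -scaleNr -scalerDl.
by congr (_ *: _ + _ *: _); ring.
Qed.

End OrthonormalBasis.

(** * Exchange inequality for optimal measurements *)

Section Discrimination.
Context {C : numClosedFieldType} {n : nat}.
Implicit Types (u v w x y : 'cV[C]_n) (A B gam E F Eq Fq : 'M[C]_n) (a s t : C).

Lemma sandwich_addmx x A B y : sandwich x (A + B) y = sandwich x A y + sandwich x B y.
Proof. by rewrite /sandwich mulmxDl braketDr. Qed.
Lemma sandwich_oppmx x A y : sandwich x (- A) y = - sandwich x A y.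
Proof. by rewrite /sandwich mulNmx braketNr. Qed.
Lemma sandwich_scalemx x a A y : sandwich x (a *: A) y = a * sandwich x A y.
Proof. by rewrite /sandwich -scalemxAl braketZr. Qed.
Lemma sandwich_scalar1 x y : sandwich x 1%:M y = braket x y.
Proof. by rewrite /sandwich mul1mx. Qed.

Lemma sandwich_comb u v A (a b c d : C) :
  sandwich (a *: u + b *: v) A (c *: u + d *: v) =
  a^* * c * sandwich u A u + a^* * d * sandwich u A v +
  b^* * c * sandwich v A u + b^* * d * sandwich v A v.
Proof. by rewrite /sandwich mulmxDr -!scalemxAr !braketE; ring. Qed.

Definition sandwich_mxE := (sandwich_addmx, sandwich_oppmx, sandwich_scalemx,
  sandwich_scalar1, @sandwich_ketbra C n).

(** Cauchy-Schwarz bounds [|<x|A y>|^2] by [<x|A|x> <y|A|y>]. It tells how much of a rank-one piece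
    along a vector in the range of [A] can be removed. *)
Lemma psd_sub_ketbra A y t : psd A -> 0 <= t -> t * sandwich y A y <= 1 ->
  psd (A - t *: ketbra (A *m y) (A *m y)).
Proof.
move=> hA t_ge0 ht; apply: psdI => [|x].
  by rewrite adjmxB adjmxZ adjmx_ketbra psd_adj // geC0_conj.
rewrite !sandwich_mxE [_^* * _]mulrC -normCK [braket _ x]braketC norm_conjC.
rewrite -/(sandwich x A y) subr_ge0.
apply: (le_trans (ler_wpM2l t_ge0 (psd_CauchySchwarz x y hA))).
by rewrite mulrCA ler_piMr ?psd_ge0.
Qed.

Lemma is_USD_sym gam1 gam2 E1 E2 Eq :
  is_USD gam1 gam2 E1 E2 Eq -> is_USD gam2 gam1 E2 E1 Eq.
Proof.
by case=> [[p1 p2 p3] [s t1 t2]]; split; split; rewrite // [E2 + E1]addrC.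
Qed.

Lemma success_sym gam1 gam2 E1 E2 : success gam1 gam2 E1 E2 = success gam2 gam1 E2 E1 :> C.
Proof. exact: addrC. Qed.

Lemma is_optimal_USD_sym gam1 gam2 E1 E2 Eq :
  is_optimal_USD gam1 gam2 E1 E2 Eq -> is_optimal_USD gam2 gam1 E2 E1 Eq.
Proof.
case=> h opt; split=> [|F1 F2 Fq hF]; first exact: is_USD_sym.
by rewrite 2!(success_sym gam2); apply/opt/is_USD_sym/hF.
Qed.

Section Pair.
Variables gam1 gam2 : 'M[C]_n.
Hypotheses (psd1 : psd gam1) (psd2 : psd gam2).

Lemma is_USD_mul0 E1 E2 Eq : is_USD gam1 gam2 E1 E2 Eq ->
  E1 *m gam2 = 0 /\ E2 *m gam1 = 0.
Proof.
by case=> [[p1 p2 p3] [s t1 t2]]; split; apply: psd_mxtraceM_eq0.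
Qed.

(** The products [E1 gam2] and [E2 gam1] vanish, so the success is the trace of
    [(E1 + E2) (gam1 + gam2)]. Measurements can thus be compared through [Eq] alone. *)
Lemma success_inconclusive E1 E2 Eq : is_USD gam1 gam2 E1 E2 Eq ->
  success gam1 gam2 E1 E2 = \tr (gam1 + gam2) - \tr (Eq *m (gam1 + gam2)).
Proof.
move=> h; have [e1 e2] := is_USD_mul0 h; case: h => _ [s _ _].
rewrite -linearB /= -{1}[gam1 + gam2]mul1mx -mulmxBl -s addrK.
by rewrite mulmxDl !mulmxDr e1 e2 addr0 add0r linearD.
Qed.

(* Trading the rank-one piece s |p><p| of E_? for E_1 while moving s/(1-sw)
   |q><q| from E_2 to E_? keeps E_? >= 0, since E_? >= |z><z|/w for z = E_? y
   and w = <y|E_?|y>. *)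
Lemma optimal_exchange E1 E2 Eq y p q y' :
  is_optimal_USD gam1 gam2 E1 E2 Eq ->
  Eq *m y = p + q -> gam2 *m p = 0 -> gam1 *m q = 0 -> q = E2 *m y' ->
  sandwich p gam1 p <= sandwich q gam2 q.
Proof.
move=> [usd opt] zE g2p g1q qE.
have [[pE1 pE2 pEq] [sumE t1 t2]] := usd.
set a := sandwich p gam1 p; set b := sandwich q gam2 q.
have a_ge0 : 0 <= a by exact: psd_ge0.
have b_ge0 : 0 <= b by exact: psd_ge0.
set w := sandwich y Eq y; set w2 := sandwich y' E2 y'.
have w_ge0 : 0 <= w by exact: psd_ge0.
have w2_ge0 : 0 <= w2 by exact: psd_ge0.
(* If [w = 0] then [Eq y = 0], hence [p = - q] lies in [ker gam1] and the left-hand side is [0]. *)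
have [w0|w_neq0] := eqVneq w 0.
  have pq : p = - q by apply/eqP; rewrite -addr_eq0 -zE (psd_eq0 pEq w0).
  by rewrite /a /sandwich {2}pq mulmxN g1q oppr0 braket0r.
have w_gt0 : 0 < w by rewrite lt_def w_neq0.
(* The bound on [s] says that [t w2 < 1], so that [E2] stays positive. Optimality makes the gain
   [s a - t b] nonpositive, which rearranges to the conclusion. *)
have main s : 0 < s -> s * (w + w2) < 1 -> (1 - s * w) * a <= b.
  move=> s_gt0 s_lt.
  have sw_lt : s * w < 1.
    by apply: le_lt_trans s_lt; rewrite mulrDr lerDl mulr_ge0 // ltW.
  have d_gt0 : 0 < 1 - s * w by rewrite subr_gt0.
  have d_neq0 := lt0r_neq0 d_gt0.
  set t := s / (1 - s * w).
  have t_ge0 : 0 <= t by rewrite divr_ge0 // ltW.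
  have USDF : is_USD gam1 gam2 (E1 + s *: ketbra p p) (E2 - t *: ketbra q q)
                (Eq - s *: ketbra p p + t *: ketbra q q).
    split; split.
    - by apply: psdD => //; apply: psdZ (psd_ketbra p); exact: ltW.
    - rewrite qE; apply: psd_sub_ketbra => //.
      rewrite -/w2 /t mulrAC ler_pdivrMr // mul1r -subr_ge0.
      by rewrite -addrA -opprD -mulrDr subr_ge0 ltW.
    (* Beyond [Eq - |z><z|/w] there remains a quadratic form in [p] and [q]; the value
       [t = s / (1 - s w)] is the one that makes its determinant vanish, so it is a single positive
       rank-one term. *)
    - suff -> : Eq - s *: ketbra p p + t *: ketbra q q =
          (Eq - w^-1 *: ketbra (Eq *m y) (Eq *m y)) +
          (w * (1 - s * w))^-1 *: ketbra ((1 - s * w) *: p + q) ((1 - s * w) *: p + q).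
        apply: psdD; first by apply: psd_sub_ketbra; rewrite // ?invr_ge0 // mulVf.
        by apply: psdZ (psd_ketbra _); rewrite invr_ge0 mulr_ge0 // ltW.
      apply: mulmx_sandwich_inj => x x'; rewrite zE !sandwich_mxE !braketE.
      rewrite (geC0_conj (ltW d_gt0)) !rmorphD !rmorphM /= (geC0_conj (ltW d_gt0)) /t.
      by field; rewrite d_neq0.
    - rewrite -sumE; move: (s *: _) (t *: _) => P Q.
      by apply/matrixP=> i j; rewrite !mxE; ring.
    - rewrite mulmxBl linearB /= t1 -scalemxAl linearZ /= mxtrace_ketbraM.
      by rewrite /sandwich g1q braket0r mulr0 subr0.
    - rewrite mulmxDl linearD /= t2 -scalemxAl linearZ /= mxtrace_ketbraM.
      by rewrite /sandwich g2p braket0r mulr0 addr0.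
  have := opt _ _ _ USDF.
  rewrite /success mulmxDl mulmxBl -!scalemxAl linearB linearD /= !linearZ /=.
  rewrite !mxtrace_ketbraM -/a -/b addrACA gerDl -/t /t subr_le0.
  by rewrite mulrAC ler_pdivlMr // -mulrA ler_pM2l // mulrC.
have [//|ba] := real_leP (ger0_real a_ge0) (ger0_real b_ge0).
have ab_gt0 : 0 < a - b by rewrite subr_gt0.
have e_ge0 : 0 <= w * a / (a - b).
  by apply: divr_ge0; [exact: mulr_ge0 | exact: ltW].
(* This replaces the limit of small [s]. With [s = k^-1], the first summands make the exchange
   feasible and the last one makes [(1 - s w) a] exceed [b] whenever [b < a]. *)
pose k := 1 + (w + w2) + w * a / (a - b).
have k_gt0 : 0 < k by rewrite ltr_wpDr // ltr_wpDr // addr_ge0.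
have s_gt0 : 0 < k^-1 by rewrite invr_gt0.
have : (1 - k^-1 * w) * a <= b.
  apply: main => //; rewrite mulrC ltr_pdivrMr // mul1r /k.
  by rewrite ltr_wpDr // ltrDr.
rewrite -subr_ge0 -(pmulr_rge0 _ k_gt0).
have -> : k * (b - (1 - k^-1 * w) * a) = - ((a - b) * (1 + (w + w2))).
  have kE : k * (a - b) = (1 + (w + w2)) * (a - b) + w * a.
    by rewrite /k mulrDl divfK // lt0r_neq0.
  have -> : k * (b - (1 - k^-1 * w) * a) = w * a - k * (a - b).
    by clearbody k; field; rewrite lt0r_neq0.
  by rewrite kE; ring.
rewrite oppr_ge0 pmulr_rle0 // => /le_lt_trans/(_ (ltr_wpDr (addr_ge0 w_ge0 w2_ge0) ltr01)).
by rewrite ltxx.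
Qed.

End Pair.
End Discrimination.

(** * Geometry of the pair *)

Section Range.
Context {C : numClosedFieldType} {n : nat}.
Implicit Types (u v w x y q phi phip : 'cV[C]_n) (A B E gam : 'M[C]_n).

(** Injectivity on column vectors is transposed, because [kermx] is a left kernel. *)
Lemma unitmx_cV A : (forall x, A *m x = 0 -> x = 0) -> A \in unitmx.
Proof.
move=> A_inj; rewrite -unitmx_tr -row_free_unit -kermx_eq0.
apply/eqP/row_matrixP => i; rewrite row0.
have : row i (kermx A^T) *m A^T = 0 by rewrite -row_mul mulmx_ker row0.
move=> /(congr1 trmx); rewrite trmx_mul trmxK trmx0 => /A_inj.
by move=> /(congr1 trmx); rewrite trmxK trmx0.
Qed.

Lemma rank1_factor m p (A : 'M[C]_(m, p)) : \rank A = 1%N ->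
  exists (u : 'cV_m) (w : 'rV_p), A = u *m w.
Proof.
move=> rA; move: (mulmx_base A).
by move: (col_base A) (row_base A); rewrite rA => u w <-; exists u, w.
Qed.

Lemma supp_mulmx A x : psd A -> supp A (A *m x).
Proof. by move=> hA w /= Aw; rewrite psd_braket // Aw braket0l. Qed.

(** Taking adjoints, [gam E = 0]: the range of [E] lies in [ker gam], to which [x] is orthogonal. *)
Lemma mulmx_supp0 E gam x : psd E -> psd gam -> E *m gam = 0 -> supp gam x ->
  E *m x = 0.
Proof.
move=> pE pg Eg gx; apply: braket_inj => w.
rewrite braket0r psd_braket //; apply: gx.
by rewrite /ker /= mulmxA -(psd_adj pg) -(psd_adj pE) -adjmxM Eg adjmx0 mul0mx.
Qed.

Section Basis.
Variables phi phip : 'cV[C]_n.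
Hypotheses (phi1 : braket phi phi = 1) (phip1 : braket phip phip = 1)
           (phi_phip : braket phi phip = 0).

Let phip_phi : braket phip phi = 0.
Proof. by rewrite braketC phi_phip conjC0. Qed.

Let S : 'M[C]_(n, 1 + 1) := row_mx phi phip.

Let adjS : S^t* = col_mx (phi^t*) (phip^t*).
Proof. by rewrite /S tr_row_mx map_col_mx. Qed.

Let SS : S^t* *m S = 1%:M.
Proof.
rewrite adjS mul_col_row [1%:M]scalar_mx_block; congr block_mx;
  by rewrite [LHS]mx11_scalar -/(braket _ _) ?phi1 ?phip1 ?phi_phip ?phip_phi
             ?raddf0.
Qed.

Let rankS : \rank S = 2%N.
Proof.
apply/eqP; rewrite eqn_leq rank_leq_col /= -{1}(mxrank1 C 2) -SS.
exact: mxrankM_maxr.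
Qed.

Let annihilated E : E *m phi = 0 -> E *m phip = 0 -> E *m S = 0.
Proof. by move=> E1 E2; rewrite /S mul_mx_row E1 E2 row_mx0. Qed.

(** The rows of [E] lie in the left kernel of the matrix with columns [phi] and [phip]. That kernel
    has dimension [n - 2], the rank of [E], so the two spaces coincide; hermiticity turns rows into
    columns. *)
Lemma corank2_range E x : E^t* = E -> (\rank E + 2)%N = n ->
  E *m phi = 0 -> E *m phip = 0 ->
  braket phi x = 0 -> braket phip x = 0 -> exists y, x = E *m y.
Proof.
move=> hE rE E1 E2 x1 x2.
have ES : (E <= kermx S)%MS by apply/sub_kermxP/annihilated.
have SE : (kermx S <= E)%MS.
  by rewrite -(mxrank_leqif_sup ES).2 mxrank_ker rankS -{3}rE addnK.
have : (x^t* <= kermx S)%MS.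
  apply/sub_kermxP; rewrite /S mul_mx_row.
  rewrite [x^t* *m phi]mx11_scalar [x^t* *m phip]mx11_scalar.
  rewrite -!/(braket _ _) ![braket x _]braketC x1 x2 conjC0 raddf0.
  by rewrite row_mx0.
move/submx_trans/(_ SE)/submxP => [D xD].
by exists (D^t*); rewrite -{1}hE -adjmxM -xD trmxCK.
Qed.

(** Removing the components along [phi] and [phip] leaves a vector that is both in the kernel of [E]
    and, by [corank2_range], in its range; for a hermitian [E] it is [0]. *)
Lemma corank2_ker E x : E^t* = E -> (\rank E + 2)%N = n ->
  E *m phi = 0 -> E *m phip = 0 -> E *m x = 0 ->
  x = braket phi x *: phi + braket phip x *: phip.
Proof.
move=> hE rE E1 E2 Ex.
set x' := x - (braket phi x *: phi + braket phip x *: phip).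
have Ex' : E *m x' = 0 by rewrite mulmxBr mulmxDr -!scalemxAr Ex E1 E2 !scaler0 addr0 subr0.
have [||y x'E] := @corank2_range E x' hE rE E1 E2.
- by rewrite !braketE phi1 phi_phip mulr1 mulr0 addr0 subrr.
- by rewrite !braketE phip1 phip_phi mulr1 mulr0 add0r subrr.
apply/eqP; rewrite -subr_eq0 -braket_eq0 -/x' {2}x'E braket_adj hE Ex' braket0l.
by [].
Qed.

(** Two inclusions bound the rank: the rows of [E] are orthogonal to [phi] and [phip], and the
    kernel of [E] is contained in their span. *)
Lemma corank2_rank E : E *m phi = 0 -> E *m phip = 0 ->
  (forall x, E *m x = 0 -> exists a b, x = a *: phi + b *: phip) ->
  (\rank E + 2)%N = n.
Proof.
move=> E1 E2 kE.
have ES : (E <= kermx S)%MS by apply/sub_kermxP/annihilated.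
have rk_n : (2 <= n)%N by rewrite -rankS rank_leq_row.
have := mxrankS ES; rewrite mxrank_ker rankS => le1.
have : (kermx E^T <= S^T)%MS.
  apply/row_subP => i; set r := row i _.
  have /kE[a [b rE]] : E *m r^T = 0.
    by apply: trmx_inj; rewrite trmx_mul trmxK -row_mul mulmx_ker row0 trmx0.
  rewrite -[r]trmxK rE /S tr_row_mx linearD /= !linearZ /=.
  apply: addmx_sub; apply: scalemx_sub; apply/submxP.
    by exists (row_mx 1%:M 0); rewrite mul_row_col mul1mx mul0mx addr0.
  by exists (row_mx 0 1%:M); rewrite mul_row_col mul1mx mul0mx add0r.
move/mxrankS; rewrite mxrank_ker !mxrank_tr rankS leq_subLR => le2.
by move: le1; rewrite leq_subRL // addnC => le1; apply/eqP; rewrite eqn_leq le1.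
Qed.

End Basis.
End Range.

(** * The oblique projection attached to the pair *)

Section PairGeometry.
Context {C : numClosedFieldType} {n : nat}.
Implicit Types (u v w x y q phi phip : 'cV[C]_n) (A B E gam : 'M[C]_n).
Variables gam1 gam2 : 'M[C]_n.
Hypotheses (psd1 : psd gam1) (psd2 : psd gam2).
Hypothesis supp_supp : supp gam1 `&` supp gam2 = [set 0].
Hypothesis ker_ker : ker gam1 `&` ker gam2 = [set 0].

Lemma ker_ker0 x : gam1 *m x = 0 -> gam2 *m x = 0 -> x = 0.
Proof.
by move=> x1 x2; have : (ker gam1 `&` ker gam2) x by []; rewrite ker_ker.
Qed.

Lemma addgam_unit : gam1 + gam2 \in unitmx.
Proof.
apply: unitmx_cV => x Gx.
have := congr1 (braket x) Gx.
rewrite mulmxDl braketDr braket0r => /eqP.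
rewrite paddr_eq0 ?psd_ge0 // => /andP[/eqP x1 /eqP x2].
by apply: ker_ker0; apply: psd_eq0.
Qed.

(** This is the projection onto [ker gam2] along [ker gam1], as the lemmas below establish. *)
Definition oblique x := invmx (gam1 + gam2) *m (gam1 *m x).

Lemma addgam_oblique x : (gam1 + gam2) *m oblique x = gam1 *m x.
Proof. by rewrite /oblique mulKVmx // addgam_unit. Qed.

(** By construction [gam1 (x - oblique x) = gam2 (oblique x)]. This vector lies in both supports and
    is therefore [0]. *)
Let oblique_both x : gam1 *m (x - oblique x) = 0 /\ gam2 *m oblique x = 0.
Proof.
have e : gam1 *m (x - oblique x) = gam2 *m oblique x.
  by rewrite mulmxBr -addgam_oblique mulmxDl addrAC subrr add0r.
suff h : gam2 *m oblique x = 0 by rewrite e.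
have : (supp gam1 `&` supp gam2) (gam2 *m oblique x).
  by split; [rewrite -e |]; apply: supp_mulmx.
by rewrite supp_supp.
Qed.

Lemma gam2_oblique x : gam2 *m oblique x = 0.
Proof. by case: (oblique_both x). Qed.
Lemma gam1_oblique x : gam1 *m oblique x = gam1 *m x.
Proof.
by case: (oblique_both x) => + _; rewrite mulmxBr => /eqP; rewrite subr_eq0 => /eqP.
Qed.

Lemma oblique_uniq x v : gam1 *m v = gam1 *m x -> gam2 *m v = 0 -> v = oblique x.
Proof.
move=> v1 v2; apply/eqP; rewrite -subr_eq0; apply/eqP/ker_ker0.
  by rewrite mulmxBr gam1_oblique v1 subrr.
by rewrite mulmxBr gam2_oblique v2 subrr.
Qed.

(** This is the complementary projection, onto [ker gam1] along [ker gam2]. *)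
Lemma invmx_gam2 x : invmx (gam1 + gam2) *m (gam2 *m x) = x - oblique x.
Proof.
apply: (can_inj (mulKmx addgam_unit)); rewrite mulKVmx ?addgam_unit //.
by rewrite mulmxBr addgam_oblique mulmxDl addrAC subrr add0r.
Qed.

Lemma obliqueZ (a : C) x : oblique (a *: x) = a *: oblique x.
Proof. by rewrite /oblique -!scalemxAr. Qed.

Lemma ker_basis phi phip x : orthonormal_basis2 (supp gam1) phi phip ->
  gam1 *m x = 0 <-> braket phi x = 0 /\ braket phip x = 0.
Proof.
case=> phi1 phip1 phi_phip suppE.
have sphi : supp gam1 phi by rewrite suppE; exists 1, 0; rewrite scale1r scale0r addr0.
have sphip : supp gam1 phip by rewrite suppE; exists 0, 1; rewrite scale1r scale0r add0r.
split=> [x0|[x1 x2]].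
  by split; rewrite braketC ?sphi ?sphip ?conjC0.
(* Expanding [gam1 (gam1 x)] in the basis and pairing with [x] computes the squared norm of
   [gam1 x]. *)
have : supp gam1 (gam1 *m (gam1 *m x)) by exact: supp_mulmx.
rewrite suppE => -[a [b e]].
apply/eqP; rewrite -braket_eq0 -psd_braket // e !braketE.
by rewrite ![braket x _]braketC x1 x2 conjC0 !mulr0 addr0.
Qed.

Lemma gam1_basis x phi phip : orthonormal_basis2 (supp gam1) phi phip ->
  gam1 *m x = gam1 *m (braket phi x *: phi + braket phip x *: phip).
Proof.
move=> h; apply/eqP; rewrite -subr_eq0 -mulmxBr; apply/eqP.
case: (h) => phi1 phip1 phi_phip _.
have phip_phi : braket phip phi = 0 by rewrite braketC phi_phip conjC0.
apply/(ker_basis _ h); split; rewrite !braketE ?phi1 ?phip1 ?phi_phip ?phip_phi.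
  by rewrite mulr1 mulr0 addr0 subrr.
by rewrite mulr1 mulr0 add0r subrr.
Qed.

End PairGeometry.

(** * Necessary conditions *)

Section Necessity.
Context {C : numClosedFieldType} {n : nat}.
Implicit Types (u v w x y q phi phip s : 'cV[C]_n) (A B E gam : 'M[C]_n).

(* First-order optimality conditions for the rank-one block of E_1 on
   supp gam1, whose kernel is spanned by phi. *)
Definition stationary gam1 gam2 phi phip (r : C) :=
  [/\ sandwich phi gam2 phip = r * sandwich phi gam1 phip,
      sandwich phip gam2 phip = r ^+ 2 * sandwich phip gam1 phip &
      0 <= sandwich phi (gam2 - gam1) phi].

Variables gam1 gam2 : 'M[C]_n.
Hypotheses (psd1 : psd gam1) (psd2 : psd gam2).
Hypothesis supp_supp : supp gam1 `&` supp gam2 = [set 0].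
Hypothesis ker_ker : ker gam1 `&` ker gam2 = [set 0].
Hypothesis supp_ker : supp gam1 `&` ker gam2 = [set 0].

(** Here [z] is [Eq phip] and [r] is [<phip|Eq|phip>]. The last inequality is the norm condition on
    the candidate vector before its normalization by the square root of [r]. *)
Lemma optimal_rank_stationary s1 s2 E1 E2 Eq :
  orthonormal_basis2 (supp gam1) s1 s2 ->
  is_optimal_USD gam1 gam2 E1 E2 Eq ->
  \rank E1 = 1%N -> (\rank E2 + 2)%N = n ->
  exists a b r : C,
    let phi := b^* *: s1 - a^* *: s2 in
    let phip := a *: s1 + b *: s2 in
    let z := phip - (1 - r) *: oblique gam1 gam2 phip in
    [/\ a * a^* + b * b^* = 1, 0 < r, r < 1,
        stationary gam1 gam2 phi phip r & braket z z < r].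
Proof.
move=> sB opt rE1 rE2.
have [usd _] := opt; have [E1g2 E2g1] := is_USD_mul0 psd1 psd2 usd.
have [[pE1 pE2 pEq] [sumE _ _]] := usd.
have g2E1 : gam2 *m E1 = 0.
  by rewrite -(psd_adj psd2) -(psd_adj pE1) -adjmxM E1g2 adjmx0.
have g1E2 : gam1 *m E2 = 0.
  by rewrite -(psd_adj psd1) -(psd_adj pE2) -adjmxM E2g1 adjmx0.
have [u [w E1uw]] := rank1_factor rE1.
have E1x x : E1 *m x = (w *m x) 0 0 *: u.
  by rewrite E1uw -mulmxA [w *m x]mx11_scalar mul_mx_scalar !mxE eqxx mulr1n.
have [y0 wy0] : exists y, (w *m y) 0 0 != 0.
  have : w != 0 by apply/eqP => w0; move: rE1; rewrite E1uw w0 mulmx0 mxrank0.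
  rewrite -subr_eq0 => /rV0Pn[j]; rewrite subr0 => wj; exists (delta_mx j 0).
  by rewrite -colE mxE.
have g2u : gam2 *m u = 0.
  have : gam2 *m (E1 *m y0) = 0 by rewrite mulmxA g2E1 mul0mx.
  by rewrite E1x -scalemxAr => /eqP; rewrite scaler_eq0 (negPf wy0) => /eqP.
have u0 : u != 0.
  by apply/eqP => u0; move: rE1; rewrite E1uw u0 mul0mx mxrank0.
(* These are the coordinates of the projection of [u] to [supp gam1]. They are not both [0], since
   [u] would otherwise lie in both kernels; [phip] is this projection, normalized. *)
set c1 := braket s1 u; set c2 := braket s2 u.
have c_neq0 : c1 * c1^* + c2 * c2^* != 0.
  rewrite -!normCK paddr_eq0 ?exprn_ge0 // !expf_eq0 /= !normr_eq0.
  apply: contra u0 => /andP[/eqP c10 /eqP c20]; apply/eqP.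
  by apply: (ker_ker0 ker_ker) => //; apply/(ker_basis psd1 _ sB).
have c_gt0 : 0 < c1 * c1^* + c2 * c2^*.
  by rewrite lt_def c_neq0 -!normCK addr_ge0 ?exprn_ge0.
set c := sqrtC (c1 * c1^* + c2 * c2^*).
have cc : c ^+ 2 = c1 * c1^* + c2 * c2^* by rewrite sqrtCK.
have cge0 : 0 <= c by rewrite sqrtC_ge0 ltW.
have cneq0 : c != 0 by rewrite sqrtC_eq0.
have ccj : c^* = c by rewrite geC0_conj.
pose a := c^-1 * c1; pose b := c^-1 * c2.
have [phip phipE] : exists x, x = a *: s1 + b *: s2 by eexists.
have [phi phiE] : exists x, x = b^* *: s1 - a^* *: s2 by eexists.
have ab1 : a * a^* + b * b^* = 1.
  rewrite /a /b !rmorphM /= !fmorphV /= ccj.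
  by rewrite mulrACA [X in _ + X]mulrACA -mulrDr -cc; field.
have phiB := orthonormal_rotate sB ab1; rewrite -phiE -phipE in phiB.
have [phi1 phip1 phi_phip suppE] := phiB.
have phip_phi : braket phip phi = 0 by rewrite braketC phi_phip conjC0.
(* The range of [E1] is the line of [v]: both [v] and the rescaled [u] lie in [ker gam2] and have
   the projection [phip] on [supp gam1]. *)
pose v := oblique gam1 gam2 phip.
have vE : v = c^-1 *: u.
  apply/esym/oblique_uniq => //; last by rewrite -scalemxAr g2u scaler0.
  rewrite -scalemxAr (gam1_basis psd1 u sB) scalemxAr phipE scalerDr !scalerA.
  by [].
have vphi : braket phi v = 0.
  have : gam1 *m v = gam1 *m phip by exact: gam1_oblique.
  move=> /eqP; rewrite -subr_eq0 -mulmxBr => /eqP/(ker_basis psd1 _ phiB)[+ _].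
  by rewrite !braketE phi_phip subr0.
have vphip : braket phip v = 1.
  have : gam1 *m v = gam1 *m phip by exact: gam1_oblique.
  move=> /eqP; rewrite -subr_eq0 -mulmxBr => /eqP/(ker_basis psd1 _ phiB)[_ +].
  by rewrite !braketE phip1 => /eqP; rewrite subr_eq0 => /eqP.
have E1v x : exists k, E1 *m x = k *: v.
  by exists ((w *m x) 0 0 * c); rewrite E1x vE scalerA mulfK.
have sphi : supp gam1 phi.
  by rewrite suppE; exists 1, 0; rewrite scale1r scale0r addr0.
have sphip : supp gam1 phip.
  by rewrite suppE; exists 0, 1; rewrite scale1r scale0r add0r.
have E2phi : E2 *m phi = 0 by exact: mulmx_supp0 pE2 psd1 E2g1 sphi.
have E2phip : E2 *m phip = 0 by exact: mulmx_supp0 pE2 psd1 E2g1 sphip.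
have E1phi : E1 *m phi = 0.
  apply: braket_inj => x; rewrite braket0r psd_braket //.
  by have [k ->] := E1v x; rewrite braketZl braketC vphi conjC0 mulr0.
have [l E1phip] := E1v phip.
have lE : l = sandwich phip E1 phip.
  by rewrite /sandwich E1phip braketZr vphip mulr1.
have l_ge0 : 0 <= l by rewrite lE psd_ge0.
(* Otherwise [E1] would annihilate [supp gam1], and its range would lie in both kernels. *)
have l_neq0 : l != 0.
  apply/eqP => l0; rewrite l0 scale0r in E1phip.
  have : gam1 *m (E1 *m y0) = 0.
    apply/(ker_basis psd1 _ phiB); rewrite !psd_braket // E1phi E1phip.
    by rewrite !braket0l.
  move=> /(ker_ker0 ker_ker)/(_ _)E1y0.
  have : E1 *m y0 = 0 by apply: E1y0; rewrite mulmxA g2E1 mul0mx.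
  rewrite E1x => /eqP; rewrite scaler_eq0 (negPf wy0) (negPf u0).
  by [].
have EqE x : Eq *m x = x - E1 *m x - E2 *m x.
  rewrite -{2}[x]mul1mx -sumE !mulmxDl [_ + _ + Eq *m x]addrC.
  by rewrite -[RHS]addrA -opprD addrK.
pose r := 1 - l.
pose z := Eq *m phip.
have zE : z = phip - (1 - r) *: v.
  by rewrite /z EqE E1phip E2phip subr0 /r subKr.
have Eqphi : Eq *m phi = phi by rewrite EqE E1phi E2phi !subr0.
have phipz : braket phip z = r.
  by rewrite zE !braketE phip1 vphip mulr1 subKr.
have r_ge0 : 0 <= r by rewrite -phipz; exact: psd_ge0.
(* Otherwise [phip = v] would be a nonzero vector of [supp gam1] in [ker gam2]. *)
have r_neq0 : r != 0.
  apply/eqP => r0; have : z = 0 by apply: psd_eq0 => //; rewrite /sandwich -/z phipz.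
  rewrite zE r0 subr0 scale1r => /eqP; rewrite subr_eq0 => /eqP phipv.
  have : (supp gam1 `&` ker gam2) phip.
    by split=> //; rewrite /ker /= phipv; apply: gam2_oblique.
  rewrite supp_ker /= => phip0; move: phip1; rewrite phip0 braket0l.
  by move/eqP; rewrite eq_sym oner_eq0.
have r_gt0 : 0 < r by rewrite lt_def r_neq0.
have r_lt1 : r < 1 by rewrite /r gtrBl lt_def l_neq0.
have [q qE] : exists x, x = phip - v by eexists.
have g1q : gam1 *m q = 0 by rewrite qE mulmxBr gam1_oblique // subrr.
have g2v : gam2 *m v = 0 by exact: gam2_oblique.
have g1v : gam1 *m v = gam1 *m phip by exact: gam1_oblique.
have zvq : z = r *: v + q.
  by rewrite zE qE scalerBl scale1r opprB addrCA.
have g2q : gam2 *m q = gam2 *m phip by rewrite qE mulmxBr g2v subr0.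
have range2 x : gam1 *m x = 0 -> exists y, x = E2 *m y.
  move=> /(ker_basis psd1 _ phiB)[h1 h2].
  by apply: (corank2_range phi1 phip1 phi_phip (psd_adj pE2)).
pose A := Eq *m (gam2 - gam1) *m Eq.
have AE x y : sandwich x A y = sandwich (Eq *m x) (gam2 - gam1) (Eq *m y).
  by rewrite /sandwich /A -!mulmxA psd_braket.
have dE x y : sandwich x (gam2 - gam1) y = sandwich x gam2 y - sandwich x gam1 y.
  by rewrite sandwich_addmx sandwich_oppmx.
(* The cross terms vanish because [gam2] annihilates [p] and [gam1] annihilates [q0]. *)
have sp x p q0 : Eq *m x = p + q0 -> gam2 *m p = 0 -> gam1 *m q0 = 0 ->
    sandwich x A x = sandwich q0 gam2 q0 - sandwich p gam1 p.
  move=> e p0 q00; rewrite AE dE e; congr (_ - _); rewrite /sandwich mulmxDr.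
    by rewrite p0 add0r psd_braket // mulmxDr p0 add0r -psd_braket.
  by rewrite q00 addr0 psd_braket // mulmxDr q00 addr0 -psd_braket.
have pA : psd A.
  apply: psdI => [|x].
    by rewrite /A !adjmxM adjmxB !psd_adj // mulmxA.
  set p := oblique gam1 gam2 (Eq *m x).
  have p0 : gam2 *m p = 0 by exact: gam2_oblique.
  have q00 : gam1 *m (Eq *m x - p) = 0 by rewrite mulmxBr gam1_oblique // subrr.
  have e : Eq *m x = p + (Eq *m x - p) by rewrite addrC subrK.
  rewrite (sp x _ _ e p0 q00) subr_ge0.
  by have [y qy] := range2 _ q00; apply: optimal_exchange opt e p0 q00 qy.
have g2rv : gam2 *m (r *: v) = 0 by rewrite -scalemxAr g2v scaler0.
have Aphip : A *m phip = 0.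
  apply: psd_eq0 => //; apply/eqP; rewrite eq_le psd_ge0 // andbT.
  rewrite (sp phip _ _ zvq) // subr_le0.
  (* With the roles exchanged, the range condition concerns [E1]: since [E1 phip = l v], the vector
     [r v] is the image of [(r / l) phip]. *)
  apply: (@optimal_exchange _ _ gam2 gam1 psd2 psd1 E2 E1 Eq phip _ _ ((r / l) *: phip)) => //.
  - exact: is_optimal_USD_sym.
  - by rewrite -/z zvq addrC.
  - by rewrite -scalemxAr E1phip scalerA divfK.
exists a, b, r; rewrite -phiE -phipE; split=> //.
  split.
  - have : sandwich phi A phip = 0 by rewrite /sandwich Aphip braket0r.
    rewrite AE Eqphi -/z zvq dE /sandwich !mulmxDr g2rv g1q add0r addr0.
    rewrite g2q -scalemxAr g1v braketZr => /eqP.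
    by rewrite subr_eq0 => /eqP.
  - have : sandwich phip A phip = 0 by rewrite /sandwich Aphip braket0r.
    rewrite (sp phip _ _ zvq) //.
    have -> : sandwich q gam2 q = sandwich phip gam2 phip.
      by rewrite /sandwich g2q (psd_braket _ _ psd2) g2q -(psd_braket _ _ psd2).
    have -> : sandwich (r *: v) gam1 (r *: v) = r ^+ 2 * sandwich phip gam1 phip.
      rewrite /sandwich -scalemxAr braketZr braketZl (geC0_conj r_ge0) g1v.
      by rewrite (psd_braket _ _ psd1) g1v -(psd_braket _ _ psd1) mulrA.
    by move/eqP; rewrite subr_eq0 => /eqP.
  - by have := psd_ge0 phi pA; rewrite AE Eqphi.
change (braket (phip - (1 - r) *: v) (phip - (1 - r) *: v) < r).
rewrite -zE.
have z_neq0 : z != 0.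
  by apply: contraNneq r_neq0 => z0; rewrite -phipz z0 braket0r.
have zz_gt0 := braket_gt0 z_neq0.
(* Equality would force [E1 z = E2 z = 0]. The kernel of [E2] being spanned by [phi] and [phip],
   this gives [z = r phip], whereas [E1 phip = l v] is not [0]. *)
have lt1 : sandwich z Eq z < braket z z.
  rewrite /sandwich EqE !braketDr !braketNr -addrA -opprD gtrBl.
  rewrite lt_def addr_ge0 ?psd_ge0 // andbT paddr_eq0 ?psd_ge0 //.
  apply/negP => /andP[/eqP/(psd_eq0 pE1) E1z /eqP/(psd_eq0 pE2) E2z].
  have := corank2_ker phi1 phip1 phi_phip (psd_adj pE2) rE2 E2phi E2phip E2z.
  have -> : braket phi z = 0 by rewrite zE !braketE phi_phip vphi mulr0 subr0.
  rewrite phipz scale0r add0r => zr.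
  have : braket phip (E1 *m z) = 0 by rewrite E1z braket0r.
  rewrite zr -scalemxAr E1phip !braketE vphip mulr1 => /eqP.
  by rewrite mulf_eq0 (negPf r_neq0) (negPf l_neq0).
(* Since [Eq phip = z], this reads [<z|z>^2 <= r <z|Eq|z>], and the right-hand side is smaller than
   [r <z|z>]. *)
have := psd_CauchySchwarz phip z pEq.
have -> : sandwich phip Eq z = braket z z by rewrite /sandwich psd_braket.
have -> : sandwich phip Eq phip = r by [].
rewrite (ger0_norm (ltW zz_gt0)) expr2 => /le_lt_trans h.
have := h (r * braket z z); rewrite ltr_pM2l // => /(_ lt1).
by rewrite ltr_pM2r.
Qed.

End Necessity.

(** * Optimality and uniqueness of the candidate measurement *)

Section Sufficiency.
Context {C : numClosedFieldType} {n : nat}.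
Implicit Types (u v w x y q : 'cV[C]_n) (A B E gam : 'M[C]_n).

Variables gam1 gam2 : 'M[C]_n.
Hypotheses (psd_gam1 : psd gam1) (psd_gam2 : psd gam2).
Hypothesis supp_supp : supp gam1 `&` supp gam2 = [set 0].
Hypothesis ker_ker : ker gam1 `&` ker gam2 = [set 0].
Hypothesis supp_ker : supp gam1 `&` ker gam2 = [set 0].

Variables (phi phip : 'cV[C]_n) (r : C).
Hypothesis phiB : orthonormal_basis2 (supp gam1) phi phip.
Hypothesis r_gt0 : 0 < r.

Let phi1 : braket phi phi = 1. Proof. by case: phiB. Qed.
Let phip1 : braket phip phip = 1. Proof. by case: phiB. Qed.
Let phi_phip : braket phi phip = 0. Proof. by case: phiB. Qed.
Let phip_phi : braket phip phi = 0. Proof. by rewrite braketC phi_phip conjC0. Qed.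
Let r_neq0 : r != 0. Proof. exact: lt0r_neq0. Qed.
Let r_conj : r^* = r. Proof. by rewrite geC0_conj // ltW. Qed.
Let s_neq0 : sqrtC r != 0. Proof. by rewrite sqrtC_eq0. Qed.
Let s_conj : (sqrtC r)^* = sqrtC r. Proof. by rewrite geC0_conj // sqrtC_ge0 ltW. Qed.

Let supp_phi : supp gam1 phi.
Proof. by case: phiB => _ _ _ ->; exists 1, 0; rewrite scale1r scale0r addr0. Qed.
Let supp_phip : supp gam1 phip.
Proof. by case: phiB => _ _ _ ->; exists 0, 1; rewrite scale1r scale0r add0r. Qed.

Let v := oblique gam1 gam2 phip.
Let nt := (sqrtC r)^-1 *: (phip - (1 - r) *: v).

(** The announced measurement, written with the component [v] of [phip] in [ker gam2]. When [r] is
    the ratio attached to [phip], [ntildeE] identifies [nt] with the vector [ntilde]. *)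
Definition USD1 : 'M[C]_n := (1 - r) *: ketbra v v.
Definition USDq : 'M[C]_n := ketbra nt nt + ketbra phi phi.
Definition USD2 : 'M[C]_n := 1%:M - USD1 - USDq.

Let g1v : gam1 *m v = gam1 *m phip. Proof. exact: gam1_oblique. Qed.
Let g2v : gam2 *m v = 0. Proof. exact: gam2_oblique. Qed.

Let phi_v : braket phi v = 0.
Proof.
move: g1v => /eqP; rewrite -subr_eq0 -mulmxBr => /eqP/(ker_basis psd_gam1 _ phiB)[+ _].
by rewrite braketDr braketNr phi_phip subr0.
Qed.

Let phip_v : braket phip v = 1.
Proof.
move: g1v => /eqP; rewrite -subr_eq0 -mulmxBr => /eqP/(ker_basis psd_gam1 _ phiB)[_ +].
by rewrite braketDr braketNr phip1 => /eqP; rewrite subr_eq0 => /eqP.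
Qed.

Let v_phip : braket v phip = 1. Proof. by rewrite braketC phip_v conjC1. Qed.
Let v_phi : braket v phi = 0. Proof. by rewrite braketC phi_v conjC0. Qed.

Let phi_nt : braket phi nt = 0.
Proof. by rewrite braketZr braketDr braketNr braketZr phi_phip phi_v mulr0 subr0 mulr0. Qed.

Let phip_nt : braket phip nt = sqrtC r.
Proof.
rewrite braketZr braketDr braketNr braketZr phip1 phip_v mulr1 subKr.
by rewrite -{2}[r]sqrtCK; field.
Qed.

Let nt_phi : braket nt phi = 0. Proof. by rewrite braketC phi_nt conjC0. Qed.
Let nt_phip : braket nt phip = sqrtC r. Proof. by rewrite braketC phip_nt. Qed.

Let sum_USD : USD1 + USD2 + USDq = 1%:M.
Proof. by rewrite /USD2 -addrA subrK addrC subrK. Qed.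

Let USD2E x : USD2 *m x = x - (1 - r) * braket v x *: v
   - braket nt x *: nt - braket phi x *: phi.
Proof.
rewrite /USD2 /USD1 /USDq !mulmxBl mulmxDl mul1mx -scalemxAl !ketbra_mul.
by rewrite scalerA opprD addrA.
Qed.

Let USD2phi : USD2 *m phi = 0.
Proof. by rewrite USD2E v_phi nt_phi phi1 mulr0 !scale0r scale1r !subr0 subrr. Qed.

Let USD2phip : USD2 *m phip = 0.
Proof.
rewrite USD2E v_phip nt_phip phi_phip mulr1 scale0r subr0 /nt scalerA.
by rewrite mulfV // scale1r opprB addrA subrK subrr.
Qed.

Let mul_gam1 E : E *m phi = 0 -> E *m phip = 0 -> E *m gam1 = 0.
Proof.
move=> h1 h2; apply: mulmx_cV_inj => x; rewrite mul0mx -mulmxA.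
have : supp gam1 (gam1 *m x) by exact: supp_mulmx.
case: phiB => _ _ _ -> [a [b ->]].
by rewrite mulmxDr -!scalemxAr h1 h2 !scaler0 addr0.
Qed.

Let mul_v_gam2 x : braket v (gam2 *m x) = 0.
Proof. by rewrite psd_braket // g2v braket0l. Qed.

Let psdq : psd USDq. Proof. by apply: psdD; exact: psd_ketbra. Qed.

Lemma USD1_phi : USD1 *m phi = 0.
Proof. by rewrite /USD1 -scalemxAl ketbra_mul v_phi scale0r scaler0. Qed.

(** * Feasibility and ranks of the announced measurement *)

Section Feasible.
Hypothesis nt_lt1 : braket nt nt < 1.

(** Cauchy-Schwarz bounds [r = |<phip|nt>|^2] by [<nt|nt>]. *)
Let r_lt1 : r < 1.
Proof.
have := psd_CauchySchwarz phip nt (@psd1 C n).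
rewrite !sandwich_scalar1 phip1 phip_nt mul1r ger0_norm ?sqrtC_ge0 ?(ltW r_gt0) //.
by rewrite sqrtCK => /le_lt_trans; apply.
Qed.

Let psdUSD1 : psd USD1.
Proof. by apply: psdZ (psd_ketbra _); rewrite subr_ge0 ltW. Qed.

Let USD2_adj : USD2^t* = USD2.
Proof. by rewrite /USD2 !adjmxB adjmx1 (psd_adj psdUSD1) (psd_adj psdq). Qed.

Let USD2_ge0 x : 0 <= sandwich x USD2 x.
Proof.
(* As [USD2] annihilates [phip] and [<v|phip> = 1], one may assume [<v|x> = 0], which removes the
   [USD1] term. Removing the component along [phi] then leaves [<y|y> - |<nt|y>|^2], nonnegative
   because [nt] has norm below [1]. *)
have [x' x'E] : exists x', x' = x - braket v x *: phip by eexists.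
have v_x' : braket v x' = 0.
  by rewrite x'E braketDr braketNr braketZr v_phip mulr1 subrr.
have -> : sandwich x USD2 x = sandwich x' USD2 x'.
  have e : USD2 *m x' = USD2 *m x.
    by rewrite x'E mulmxBr -scalemxAr USD2phip scaler0 subr0.
  by rewrite /sandwich -e [LHS]braket_adj USD2_adj -e -{1}USD2_adj -braket_adj.
have [y yE] : exists y, y = x' - braket phi x' *: phi by eexists.
have phi_y : braket phi y = 0.
  by rewrite yE braketDr braketNr braketZr phi1 mulr1 subrr.
have nt_y : braket nt x' = braket nt y.
  by rewrite yE braketDr braketNr braketZr nt_phi mulr0 subr0.
have -> : sandwich x' USD2 x' = braket y y - `|braket nt y| ^+ 2.
  rewrite /sandwich USD2E v_x' mulr0 scale0r subr0.
  have x'y : x' = y + braket phi x' *: phi by rewrite yE subrK.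
  rewrite addrAC -yE braketDr braketNr braketZr nt_y [braket x' nt]braketC nt_y.
  rewrite -normCK {1}x'y braketDl braketZl phi_y mulr0 addr0.
  by [].
rewrite subr_ge0.
have := psd_CauchySchwarz nt y (@psd1 C n); rewrite !sandwich_scalar1.
move=> /le_trans; apply; rewrite ler_piMl ?braket_ge0 //.
exact: ltW.
Qed.

Lemma stationary_is_USD : is_USD gam1 gam2 USD1 USD2 USDq.
Proof.
split; split=> //; first exact: psdI.
  by rewrite mul_gam1 // linear0.
rewrite /USD1 -scalemxAl linearZ /= mxtrace_ketbraM /sandwich mul_v_gam2.
by rewrite mulr0.
Qed.

Lemma stationary_rank1 : \rank USD1 = 1%N.
Proof.
have le1 : (\rank USD1 <= 1)%N by rewrite /USD1 /ketbra scalemxAl mulmx_max_rank.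
apply/eqP; rewrite eqn_leq le1 lt0n mxrank_eq0; apply/eqP => U0.
have : braket phip (USD1 *m phip) = 0 by rewrite U0 mul0mx braket0r.
rewrite /USD1 -scalemxAl ketbra_mul v_phip scale1r braketZr phip_v mulr1.
by move=> /eqP; rewrite subr_eq0 => /eqP r1; move: r_lt1; rewrite -r1 ltxx.
Qed.

(** The kernel is exactly the span of [phi] and [phip]. A kernel vector with [<v|x'> = 0] is a
    combination of [nt] and [phi], and pairing with [nt] gives [<nt|x'> = <nt|nt> <nt|x'>], hence
    [<nt|x'> = 0]. *)
Lemma stationary_rank2 : (\rank USD2 + 2)%N = n.
Proof.
apply: (corank2_rank phi1 phip1 phi_phip) => // x Ux.
have [x' x'E] : exists x', x' = x - braket v x *: phip by eexists.
have v_x' : braket v x' = 0.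
  by rewrite x'E braketDr braketNr braketZr v_phip mulr1 subrr.
have : USD2 *m x' = 0.
  by rewrite x'E mulmxBr -scalemxAr USD2phip scaler0 subr0.
rewrite USD2E v_x' mulr0 scale0r subr0 => /eqP; rewrite subr_eq0 subr_eq.
move=> /eqP x'_dec.
have /eqP : braket nt x' = braket nt nt * braket nt x'.
  by rewrite {1}x'_dec braketDr !braketZr nt_phi mulr0 add0r mulrC.
rewrite -{1}[braket nt x']mul1r -subr_eq0 -mulrBl mulf_eq0 subr_eq0.
rewrite eq_sym (lt_eqF nt_lt1) /= => /eqP nt_x'.
exists (braket phi x'), (braket v x).
rewrite nt_x' scale0r addr0 in x'_dec.
by rewrite -x'_dec x'E subrK.
Qed.

(** This recovers the line of [phi] from the operator [USD1], so that equal measurements come from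
    proportional vectors [phi]. *)
Lemma USD1_ker x : supp gam1 x -> USD1 *m x = 0 -> exists c, x = c *: phi.
Proof.
case: phiB => _ _ _ -> [a [b ->]].
rewrite /USD1 -scalemxAl ketbra_mul braketDr !braketZr v_phi v_phip mulr0 add0r mulr1.
move=> /(congr1 (braket phip)); rewrite !braketZr phip_v mulr1 braket0r => /eqP.
rewrite mulf_eq0 subr_eq0 (gt_eqF r_lt1) /= => /eqP ->.
by exists a; rewrite scale0r addr0.
Qed.

End Feasible.

(** * The dual certificate *)

Section Optimal.
Hypothesis stat : stationary gam1 gam2 phi phip r.
Let sig := sandwich phi (gam2 - gam1) phi.

Let sig_ge0 : 0 <= sig. Proof. by case: stat. Qed.

Let W : 'M[C]_n := ketbra phi phi + r^-1 *: ketbra phip phip.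

Let WE x : W *m x = braket phi x *: phi + (r^-1 * braket phip x) *: phip.
Proof. by rewrite /W mulmxDl -scalemxAl !ketbra_mul scalerA. Qed.

Let psdW : psd W.
Proof.
apply: psdD; first exact: psd_ketbra.
by apply: psdZ (psd_ketbra _); rewrite invr_ge0 ltW.
Qed.

Let W_adj : W^t* = W. Proof. exact: psd_adj. Qed.

(** Both sides live on [supp gam1]. Their matrix elements in the basis [(phi, phip)] agree by the
    stationarity equations, and [sig] accounts for the [phi], [phi] entry. *)
Let WgW : W *m gam2 *m W = gam1 + sig *: ketbra phi phi.
Proof.
case: stat => K1 K2 _.
have K1' : sandwich phip gam2 phi = r * sandwich phip gam1 phi.
  rewrite sandwichC; last exact: psd_adj.
  by rewrite K1 rmorphM /= r_conj -sandwichC //; exact: psd_adj.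
apply: mulmx_sandwich_inj => x y; rewrite sandwich_addmx.
have -> : sandwich x gam1 y = sandwich (braket phi x *: phi + braket phip x *: phip)
    gam1 (braket phi y *: phi + braket phip y *: phip).
  rewrite /sandwich -(gam1_basis psd_gam1 _ phiB) (psd_braket _ _ psd_gam1).
  by rewrite (gam1_basis psd_gam1 x phiB) -(psd_braket _ _ psd_gam1).
have -> : sandwich x (W *m gam2 *m W) y = sandwich (W *m x) gam2 (W *m y).
  by rewrite /sandwich -!mulmxA braket_adj W_adj.
rewrite !WE !sandwich_comb K1 K1' K2 /sig !sandwich_mxE.
by rewrite rmorphM fmorphV /= r_conj; field.
Qed.

(** Up to cyclicity this is the trace of [Z E] for the certificate [Z = (W - 1) gam2 (W - 1)]; the
    order shows a product of two positive operators. *)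
Let defect E := \tr ((W - 1%:M) *m E *m (W - 1%:M) *m gam2).

Let W1_adj : (W - 1%:M)^t* = W - 1%:M.
Proof. by rewrite adjmxB W_adj adjmx1. Qed.

Let defect_ge0 E : psd E -> 0 <= defect E.
Proof. by move=> pE; apply: psd_mxtraceM_ge0 => //; apply: psd_congr. Qed.

(** A vanishing trace makes the product itself vanish, so [E] has zero expectation at each
    [(W - 1) gam2 x] and annihilates it. *)
Let defect_eq0 E : psd E -> defect E = 0 -> E *m W *m gam2 = E *m gam2.
Proof.
move=> pE E0.
have F0 := psd_mxtraceM_eq0 (psd_congr pE W1_adj) psd_gam2 E0.
suff : E *m (W - 1%:M) *m gam2 = 0.
  by rewrite mulmxBr mulmxBl mulmx1 => /eqP; rewrite subr_eq0 => /eqP.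
apply: mulmx_cV_inj => x; rewrite mul0mx -!mulmxA; apply: psd_eq0 => //.
have : sandwich (gam2 *m x) ((W - 1%:M) *m E *m (W - 1%:M)) (gam2 *m x) = 0.
  by rewrite /sandwich mulmxA F0 mul0mx braket0r.
by rewrite /sandwich -!mulmxA braket_adj W1_adj.
Qed.

Section Compare.
Variables F1 F2 Fq : 'M[C]_n.
Hypothesis usd : is_USD gam1 gam2 F1 F2 Fq.

Let pFq : psd Fq. Proof. by case: usd => [[]]. Qed.
Let FqE : Fq = 1%:M - F1 - F2.
Proof. by case: usd => _ [<- _ _]; apply/matrixP=> i j; rewrite !mxE; ring. Qed.
Let F1g2 : F1 *m gam2 = 0.
Proof. by case: (is_USD_mul0 psd_gam1 psd_gam2 usd). Qed.
Let F2g1 : F2 *m gam1 = 0.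
Proof. by case: (is_USD_mul0 psd_gam1 psd_gam2 usd). Qed.
Let pF1 : psd F1. Proof. by case: usd => [[]]. Qed.
Let pF2 : psd F2. Proof. by case: usd => [[]]. Qed.

Let WF2 : W *m F2 = 0.
Proof.
suff F2W : F2 *m W = 0 by rewrite -W_adj -(psd_adj pF2) -adjmxM F2W adjmx0.
apply: mulmx_cV_inj => x; rewrite mul0mx -mulmxA WE mulmxDr -!scalemxAr.
rewrite (mulmx_supp0 pF2 psd_gam1 F2g1 supp_phi).
by rewrite (mulmx_supp0 pF2 psd_gam1 F2g1 supp_phip) !scaler0 addr0.
Qed.

(** The range of [W] lies in [supp gam1], whence [W F2 = 0], and [F1 gam2 = 0]. This block of [Fq]
    is thus the same for all measurements. *)
Lemma stationary_WFg : W *m Fq *m gam2 = W *m gam2.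
Proof. by rewrite FqE !mulmxBr WF2 mulmx1 subr0 mulmxBl -mulmxA F1g2 mulmx0 subr0. Qed.

Let WFg := stationary_WFg.

Let gFW : gam2 *m Fq *m W = gam2 *m W.
Proof.
have := congr1 (fun A => A^t*) WFg.
by rewrite !adjmxM W_adj (psd_adj pFq) (psd_adj psd_gam2) mulmxA.
Qed.

(** Of the four terms of the expansion, the mixed ones are constant by [stationary_WFg], and [WgW]
    converts the doubly weighted one into a [gam1] term plus a [sig] term. *)
Lemma stationary_defect : defect Fq = \tr (Fq *m (gam1 + gam2))
  + sig * sandwich phi Fq phi - \tr (W *m gam2) *+ 2.
Proof.
rewrite /defect !mulmxBl !mulmxBr !mulmx1 !mul1mx !mulmxBl WFg !linearB /=.
have -> : \tr (W *m Fq *m W *m gam2) = \tr (gam1 *m Fq) + sig * sandwich phi Fq phi.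
  rewrite -mulmxA mxtrace_mulC mulmxA WgW mulmxDl linearD /=.
  by rewrite -scalemxAl linearZ /= mxtrace_ketbraM.
have -> : \tr (Fq *m W *m gam2) = \tr (W *m gam2).
  by rewrite mxtrace_mulC mulmxA gFW mxtrace_mulC.
rewrite mulmxDr linearD /= [\tr (gam1 *m _)]mxtrace_mulC mulr2n; ring.
Qed.

Lemma sandwich_phi_le1 : sandwich phi Fq phi <= 1.
Proof.
rewrite FqE !sandwich_mxE phi1 -addrA -opprD gerBl addr_ge0 ?psd_ge0 //.
Qed.

End Compare.

(** Both generators of [USDq] are annihilated by [gam2 (W - 1)]: [W phi = phi], and [(W - 1) nt] is
    a multiple of [v], which lies in [ker gam2]. *)
Let defectq : defect USDq = 0.
Proof.
rewrite /defect -mulmxA -(mulmxA _ USDq).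
suff -> : USDq *m ((W - 1%:M) *m gam2) = 0 by rewrite mulmx0 linear0.
apply: mulmx_cV_inj => x; rewrite mul0mx -mulmxA mulmxDl !ketbra_mul.
have -> : braket phi ((W - 1%:M) *m gam2 *m x) = 0.
  rewrite -mulmxA braket_adj W1_adj mulmxBl WE mul1mx phi1 phip_phi.
  by rewrite mulr0 scale0r scale1r addr0 subrr braket0l.
have -> : braket nt ((W - 1%:M) *m gam2 *m x) = 0.
  rewrite -mulmxA braket_adj W1_adj psd_braket // mulmxBl WE mul1mx phi_nt phip_nt.
  rewrite scale0r add0r mulmxBr -!scalemxAr mulmxBr -scalemxAr g2v scaler0 subr0.
  have -> : r^-1 * sqrtC r = (sqrtC r)^-1 by rewrite -{1}[r]sqrtCK; field.
  by rewrite subrr braket0l.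
by rewrite !scale0r addr0.
Qed.

Let phi_USDq : sandwich phi USDq phi = 1.
Proof.
by rewrite /sandwich /USDq mulmxDl !ketbra_mul nt_phi phi1 scale0r scale1r add0r.
Qed.

Hypothesis nt_lt1 : braket nt nt < 1.

(** Subtracting [stationary_defect] for the two measurements cancels the constant trace of
    [W gam2]. *)
Let success_gap F1 F2 Fq : is_USD gam1 gam2 F1 F2 Fq ->
  success gam1 gam2 USD1 USD2 - success gam1 gam2 F1 F2 =
  sig * (1 - sandwich phi Fq phi) + defect Fq.
Proof.
move=> usdF; have usdE := stationary_is_USD nt_lt1.
rewrite (success_inconclusive psd_gam1 psd_gam2 usdE).
rewrite (success_inconclusive psd_gam1 psd_gam2 usdF).
have := stationary_defect usdE; rewrite defectq phi_USDq => e.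
by rewrite (stationary_defect usdF) -[LHS]addr0 {1}e; ring.
Qed.

Let gap_ge0 F1 F2 Fq : is_USD gam1 gam2 F1 F2 Fq ->
  0 <= sig * (1 - sandwich phi Fq phi).
Proof. by move=> h; rewrite mulr_ge0 // subr_ge0 (sandwich_phi_le1 h). Qed.

Lemma stationary_is_optimal : is_optimal_USD gam1 gam2 USD1 USD2 USDq.
Proof.
split=> [|F1 F2 Fq usdF]; first exact: stationary_is_USD.
rewrite -subr_ge0 (success_gap usdF) addr_ge0 ?(gap_ge0 usdF) ?defect_ge0 //.
by case: usdF => [[]].
Qed.

Lemma stationary_optimal_uniq F1 F2 Fq : is_optimal_USD gam1 gam2 F1 F2 Fq ->
  [/\ F1 = USD1, F2 = USD2 & Fq = USDq].
Proof.
case=> usdF optF; have usdE := stationary_is_USD nt_lt1.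
have pFq : psd Fq by case: usdF => [[]].
have dF : defect Fq = 0.
  apply/eqP; rewrite eq_le defect_ge0 // andbT.
  have := optF _ _ _ usdE; rewrite -subr_le0 (success_gap usdF).
  by apply: le_trans; rewrite lerDr (gap_ge0 usdF).
have FqE : Fq = USDq.
  (* The difference [D] is shown to vanish in all four blocks formed by [W] and [gam2]; since
     [W + gam2] is invertible, [D = 0]. *)
  have [D DE] : exists D, D = Fq - USDq by eexists.
  have D_adj : D^t* = D by rewrite DE adjmxB !psd_adj.
  have DWg : D *m W *m gam2 = D *m gam2.
    by rewrite DE !mulmxBl (defect_eq0 pFq dF) (defect_eq0 psdq defectq).
  have WDg : W *m D *m gam2 = 0.
    rewrite DE mulmxBr mulmxBl (stationary_WFg usdF) (stationary_WFg usdE).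
    by rewrite subrr.
  have gDW : gam2 *m D *m W = 0.
    by rewrite -(psd_adj psd_gam2) -W_adj -D_adj -!adjmxM mulmxA WDg adjmx0.
  have gDg : gam2 *m D *m gam2 = 0.
    by rewrite -mulmxA -DWg !mulmxA gDW mul0mx.
  have gWDW : gam2 *m (W *m D *m W) = 0.
    have : W *m D *m W *m gam2 = 0 by rewrite -!mulmxA (mulmxA D) DWg mulmxA WDg.
    move/(congr1 (fun A => A^t*)).
    by rewrite adjmx0 !adjmxM W_adj D_adj (psd_adj psd_gam2) !mulmxA.
  (* The values of [W D W] lie in [supp gam1], by the form of [W], and in [ker gam2], by [gWDW]. *)
  have WDW : W *m D *m W = 0.
    apply: mulmx_cV_inj => x; rewrite mul0mx.
    have : (supp gam1 `&` ker gam2) (W *m D *m W *m x).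
      split; last by rewrite /ker /= mulmxA gWDW mul0mx.
      rewrite -!mulmxA WE; case: phiB => _ _ _ ->.
      by eexists; eexists; reflexivity.
    by rewrite supp_ker.
  have U : W + gam2 \in unitmx.
    apply: unitmx_cV => x Gx.
    have := congr1 (braket x) Gx.
    rewrite mulmxDl braketDr braket0r => /eqP.
    rewrite paddr_eq0 ?psd_ge0 // => /andP[/eqP x1 /eqP x2].
    apply: (ker_ker0 ker_ker); last exact: psd_eq0 x2.
    have Wx := psd_eq0 psdW x1; rewrite WE in Wx.
    apply/(ker_basis psd_gam1 _ phiB); split.
      have := congr1 (braket phi) Wx.
      by rewrite braketDr !braketZr phi1 phi_phip mulr1 mulr0 addr0 braket0r.
    have := congr1 (braket phip) Wx.
    rewrite braketDr !braketZr phip1 phip_phi mulr1 mulr0 add0r braket0r => /eqP.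
    by rewrite mulf_eq0 invr_eq0 (negPf r_neq0) => /eqP.
  have : (W + gam2) *m D *m (W + gam2) = 0.
    have expand (A B E : 'M[C]_n) : (A + B) *m E *m (A + B) =
        A *m E *m A + B *m E *m A + (A *m E *m B + B *m E *m B).
      by rewrite mulmxDl mulmxDr !mulmxDl.
    rewrite expand WDW WDg gDW gDg.
    by rewrite !addr0.
  move/(congr1 (fun A => invmx (W + gam2) *m A *m invmx (W + gam2))).
  rewrite !mulmxA mulVmx // mul1mx mulmxK // mulmx0 mul0mx DE => /eqP.
  by rewrite subr_eq0 => /eqP.
suff F1E : F1 = USD1.
  split=> //; case: (usdF) => _ [sF _ _]; case: (usdE) => _ [sE _ _].
  by move: sF; rewrite -sE F1E FqE => /addIr/addrI.
have [F1g2 F2g1] := is_USD_mul0 psd_gam1 psd_gam2 usdF.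
have [U1g2 U2g1] := is_USD_mul0 psd_gam1 psd_gam2 usdE.
(* Given the inconclusive operator, [G1] is determined by its product with the invertible
   [gam1 + gam2]. *)
have dec G1 G2 : G2 *m gam1 = 0 -> G1 *m gam2 = 0 -> G1 + G2 + USDq = 1%:M ->
    G1 *m (gam1 + gam2) = gam1 - USDq *m gam1.
  move=> h2 h1 h; have -> : G1 = 1%:M - USDq - G2 by rewrite -h addrK addrK.
  have := h1; rewrite -[G1](addrK G2) -[G1 + G2](addrK USDq) h => {}h1.
  by rewrite mulmxDr h1 addr0 2!mulmxBl mul1mx h2 subr0.
apply: (can_inj (mulmxK (addgam_unit psd_gam1 psd_gam2 ker_ker))).
have sF : F1 + F2 + USDq = 1%:M by rewrite -FqE; case: usdF => _ [].
by rewrite (dec _ _ F2g1 F1g2 sF) (dec _ _ U2g1 U1g2 sum_USD).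
Qed.

End Optimal.
End Sufficiency.

(** * Candidates *)

Section Candidates.
Context {C : numClosedFieldType} {n : nat}.
Implicit Types (u v w x y q : 'cV[C]_n).

Variables gam1 gam2 : 'M[C]_n.
Hypotheses (psd_gam1 : psd gam1) (psd_gam2 : psd gam2).
Hypothesis supp_supp : supp gam1 `&` supp gam2 = [set 0].
Hypothesis ker_ker : ker gam1 `&` ker gam2 = [set 0].
Hypothesis supp_ker : supp gam1 `&` ker gam2 = [set 0].

Lemma supp_gam1_gt0 v : supp gam1 v -> v != 0 -> 0 < sandwich v gam1 v.
Proof.
move=> sv v0; rewrite lt_def psd_ge0 // andbT; apply: contra v0.
by move=> /eqP/(psd_eq0 psd_gam1)/sv/eqP; rewrite braket_eq0.
Qed.

Lemma supp_gam2_gt0 v : supp gam1 v -> v != 0 -> 0 < sandwich v gam2 v.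
Proof.
move=> sv v0; rewrite lt_def psd_ge0 // andbT; apply: contra v0.
move=> /eqP/(psd_eq0 psd_gam2) kv.
by have : (supp gam1 `&` ker gam2) v by []; rewrite supp_ker => /= ->.
Qed.

Lemma ratio_gt0 v : supp gam1 v -> v != 0 -> 0 < Defs.ratio gam1 gam2 v.
Proof.
by move=> sv v0; rewrite sqrtC_gt0 divr_gt0 ?supp_gam1_gt0 ?supp_gam2_gt0.
Qed.

Lemma ratio_sqr v : supp gam1 v -> v != 0 ->
  sandwich v gam2 v = Defs.ratio gam1 gam2 v ^+ 2 * sandwich v gam1 v.
Proof.
move=> sv v0; rewrite sqrtCK divfK //.
by apply/lt0r_neq0/supp_gam1_gt0.
Qed.

Lemma ratio_uniq v r : supp gam1 v -> v != 0 -> 0 < r ->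
  sandwich v gam2 v = r ^+ 2 * sandwich v gam1 v -> Defs.ratio gam1 gam2 v = r.
Proof.
move=> sv v0 r0 e; rewrite /Defs.ratio e mulfK ?lt0r_neq0 ?supp_gam1_gt0 //.
by rewrite sqrCK // ltW.
Qed.

(** With [P] the oblique projection, the operator in [ntilde] is [sqrt r P + (1 - P) / sqrt r]. *)
Lemma ntildeE v : supp gam1 v -> v != 0 ->
  ntilde gam1 gam2 v = (sqrtC (Defs.ratio gam1 gam2 v))^-1 *:
    (v - (1 - Defs.ratio gam1 gam2 v) *: oblique gam1 gam2 v).
Proof.
move=> sv v0; rewrite /ntilde mulmxDl mulmxDr -!scalemxAl -!scalemxAr.
rewrite (invmx_gam2 psd_gam1 psd_gam2 ker_ker) -/(oblique gam1 gam2 v).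
have r0 := ratio_gt0 sv v0; set r := Defs.ratio _ _ _ in r0 *.
have s0 : sqrtC r != 0 by rewrite sqrtC_eq0 lt0r_neq0.
rewrite !scalerBr addrCA; congr (_ + _).
rewrite scalerA -scalerBl -scaleNr; congr (_ *: _).
by rewrite -{4}[r]sqrtCK; field.
Qed.

Lemma ntilde_lt1 v r : supp gam1 v -> v != 0 -> Defs.ratio gam1 gam2 v = r ->
  (braket (ntilde gam1 gam2 v) (ntilde gam1 gam2 v) < 1) =
  (braket (v - (1 - r) *: oblique gam1 gam2 v) (v - (1 - r) *: oblique gam1 gam2 v) < r).
Proof.
move=> sv v0 rE; rewrite ntildeE // rE braketZl braketZr.
have r0 : 0 < r by rewrite -rE ratio_gt0.
have s_ge0 : 0 <= sqrtC r by rewrite sqrtC_ge0 ltW.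
rewrite mulrA fmorphV /= (geC0_conj s_ge0) -invfM -expr2 sqrtCK.
by rewrite mulrC ltr_pdivrMr // mul1r.
Qed.

Variables (g11 g12 : C) (s1 s2 : 'cV[C]_n).
Hypothesis sB : orthonormal_basis2 (supp gam1) s1 s2.
Hypotheses (eig1 : gam1 *m s1 = g11 *: s1) (eig2 : gam1 *m s2 = g12 *: s2).
Hypotheses (g11_ge_g12 : g12 <= g11) (g12_gt0 : 0 < g12).
Hypothesis g23_ge0 : 0 <= sandwich s1 gam2 s2.

Let s11 : braket s1 s1 = 1. Proof. by case: sB. Qed.
Let s22 : braket s2 s2 = 1. Proof. by case: sB. Qed.
Let s12 : braket s1 s2 = 0. Proof. by case: sB. Qed.
Let s21 : braket s2 s1 = 0. Proof. by rewrite braketC s12 conjC0. Qed.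

Let g21 := sandwich s1 gam2 s1.
Let g22 := sandwich s2 gam2 s2.
Let g23 := sandwich s1 gam2 s2.
Let g1 := g11 - g12.
Let g2 := g21 - g22.

Let g11_gt0 : 0 < g11. Proof. exact: lt_le_trans g12_gt0 g11_ge_g12. Qed.
Let g11_real : g11 \is Num.real. Proof. exact: gtr0_real. Qed.
Let g12_real : g12 \is Num.real. Proof. exact: gtr0_real. Qed.
Let g1_real : g1 \is Num.real. Proof. exact: realB. Qed.
Let g21_real : g21 \is Num.real. Proof. by apply/ger0_real/psd_ge0. Qed.
Let g22_real : g22 \is Num.real. Proof. by apply/ger0_real/psd_ge0. Qed.
Let g23_real : g23 \is Num.real. Proof. exact: ger0_real. Qed.
Let g2_real : g2 \is Num.real. Proof. exact: realB. Qed.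

Let gam1_comb a b c d : sandwich (a *: s1 + b *: s2) gam1 (c *: s1 + d *: s2) =
  a^* * c * g11 + b^* * d * g12.
Proof.
rewrite sandwich_comb /sandwich eig1 eig2 !braketZr s11 s22 s12 s21.
by ring.
Qed.

Let gam2_comb a b c d : sandwich (a *: s1 + b *: s2) gam2 (c *: s1 + d *: s2) =
  a^* * c * g21 + (a^* * d + b^* * c) * g23 + b^* * d * g22.
Proof.
rewrite sandwich_comb.
have -> : sandwich s2 gam2 s1 = g23.
  by rewrite sandwichC ?psd_adj // geC0_conj.
by rewrite -/g21 -/g22 -/g23; ring.
Qed.

Let norm1x (x : C) : x \is Num.real -> exists2 k : C, 0 < k &
  k ^+ 2 * (1 + x ^+ 2) = 1 /\ (sqrtC (1 + x ^+ 2))^-1 = k.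
Proof.
move=> xR.
have h : 0 < 1 + x ^+ 2 by rewrite ltr_wpDr // -realEsqr.
exists (sqrtC (1 + x ^+ 2))^-1; first by rewrite invr_gt0 sqrtC_gt0.
by split=> //; rewrite exprVn sqrtCK mulVf // lt0r_neq0.
Qed.

Let phi_ofE (x k : C) : (sqrtC (1 + x ^+ 2))^-1 = k ->
  phi_of s1 s2 x = k *: s1 + (k * x) *: s2.
Proof. by move=> kE; rewrite /phi_of kE scalerDr scalerA. Qed.

Let phiperp_ofE (x k : C) : (sqrtC (1 + x ^+ 2))^-1 = k ->
  phiperp_of s1 s2 x = (k * x) *: s1 + (- k) *: s2.
Proof. by move=> kE; rewrite /phiperp_of kE scalerBr scalerA scaleNr. Qed.

(** The sign condition of the candidates enters here: it discards the solution [A = - r B]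
    introduced by squaring. *)
Let sqr_eq_pos (r A B : C) : 0 < r -> A \is Num.real -> B \is Num.real ->
  A ^+ 2 = r ^+ 2 * B ^+ 2 -> 0 <= B * A -> A = r * B.
Proof.
move=> r0 AR BR /eqP; rewrite -exprMn eqf_sqr => /orP[/eqP//|/eqP ->].
rewrite mulrN oppr_ge0 mulrCA pmulr_rle0 // -expr2 => B2.
have /eqP : B ^+ 2 = 0 by apply/eqP; rewrite eq_le B2 -realEsqr.
by rewrite expf_eq0 /= => /eqP ->; rewrite mulr0 oppr0.
Qed.

(** In terms of [x], the off-diagonal stationarity equation is [x g2 + (x^2 - 1) g23 = r x g1]. The
    candidate polynomial is its square with [r^2] eliminated by the definition of the ratio. *)
Lemma candidate_stationary phi phip :
  is_candidate gam1 gam2 g11 g12 s1 s2 phi phip ->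
  orthonormal_basis2 (supp gam1) phi phip /\
  stationary gam1 gam2 phi phip (Defs.ratio gam1 gam2 phip).
Proof.
have dE u : sandwich u (gam2 - gam1) u = sandwich u gam2 u - sandwich u gam1 u.
  by rewrite sandwich_addmx sandwich_oppmx.
case=> [[g23_0 [[le1 [-> ->]]|[le2 [-> ->]]]]|].
- split=> //; have [sv v0] := orthonormal_basis_mem sB; split.
  + by rewrite g23_0 /sandwich eig2 braketZr s12 !mulr0.
  + exact: ratio_sqr.
  + by rewrite dE [sandwich _ gam1 _]/sandwich eig1 braketZr s11 mulr1 subr_ge0.
- have sB' := orthonormal_basis_swap sB.
  split=> //; have [sv v0] := orthonormal_basis_mem sB'; split.
  + rewrite sandwichC ?psd_adj // g23_0 conjC0.
    by rewrite /sandwich eig1 braketZr s21 !mulr0.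
  + exact: ratio_sqr.
  + by rewrite dE [sandwich _ gam1 _]/sandwich eig2 braketZr s22 mulr1 subr_ge0.
rewrite -/g21 -/g22 -/g23 => -[_ [x [xR x0 poly sgn [K3 -> ->]]]].
have [k k0 [k2 kE]] := norm1x xR.
have kR : k^* = k by rewrite geC0_conj // ltW.
have xC : x^* = x by apply/CrealP.
rewrite (phi_ofE kE) (phiperp_ofE kE) in K3 *.
have phiB : orthonormal_basis2 (supp gam1) (k *: s1 + (k * x) *: s2)
              ((k * x) *: s1 + (- k) *: s2).
  have ab1 : (k * x) * (k * x)^* + (- k) * (- k)^* = 1.
    by rewrite rmorphN rmorphM /= kR xC -[RHS]k2; ring.
  have := orthonormal_basis_opp (orthonormal_rotate sB ab1).
  rewrite rmorphN rmorphM /= kR xC.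
  suff -> : - (- k *: s1 - (k * x) *: s2) = k *: s1 + (k * x) *: s2 by [].
  by rewrite scaleNr -opprD opprK.
have [sv v0] := orthonormal_basis_mem phiB.
split=> //; split=> //; last exact: ratio_sqr.
have r2 := ratio_sqr sv v0; have r0 := ratio_gt0 sv v0.
move: r2 r0; set r := Defs.ratio _ _ _ => r2 r0.
move: r2; rewrite !gam1_comb !gam2_comb rmorphN rmorphM /= kR xC => r2.
set A := (X in X = _); set B := (X in _ = _ * X).
have AE : A = k ^+ 2 * (x * g2 + (x ^+ 2 - 1) * g23) by rewrite /A /g2; ring.
have BE : B = k ^+ 2 * (x * g1) by rewrite /B /g1; ring.
have kreal : k \is Num.real by exact: gtr0_real.
apply: sqr_eq_pos => //.
- by rewrite AE !(rpredM, rpredX, rpredD, rpredN, rpred1).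
- by rewrite BE !(rpredM, rpredX).
- have p0 : 0 < x ^+ 2 * g11 + g12.
    by rewrite ltr_wpDl // mulr_ge0 ?(ltW g11_gt0) // -realEsqr.
  have r2' : x ^+ 2 * g21 + g22 - 2 * x * g23 = r ^+ 2 * (x ^+ 2 * g11 + g12).
    have k20 : k ^+ 2 != 0 by rewrite expf_neq0 // lt0r_neq0.
    apply: (mulfI k20); apply/eqP; rewrite -subr_eq0.
    by move/eqP: r2; rewrite -subr_eq0; congr (_ == 0); ring.
  apply: (mulIf (lt0r_neq0 p0)).
  rewrite AE BE; move/eqP: poly; rewrite r2' subr_eq0 => /eqP poly.
  have -> : (k ^+ 2 * (x * g2 + (x ^+ 2 - 1) * g23)) ^+ 2 * (x ^+ 2 * g11 + g12) =
     (k ^+ 2) ^+ 2 * ((x * g2 + (x ^+ 2 - 1) * g23) ^+ 2 * (x ^+ 2 * g11 + g12)) by ring.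
  by rewrite -poly /g1; ring.
rewrite AE BE.
have -> : k ^+ 2 * (x * g1) * (k ^+ 2 * (x * g2 + (x ^+ 2 - 1) * g23)) =
  (k ^+ 2) ^+ 2 * (x * g1 * (x * g2 + g23 * (x ^+ 2 - 1))) by ring.
by rewrite mulr_ge0 // exprn_ge0 // exprn_ge0 // ltW.
Qed.

Let g23_conj : g23^* = g23. Proof. exact/CrealP. Qed.

(** A candidate has a prescribed phase, so the given vector matches it only up to the unimodular
    factor [l]. *)
Lemma stationary_candidate (a b r : C) :
  a * a^* + b * b^* = 1 -> 0 < r -> r < 1 ->
  stationary gam1 gam2 (b^* *: s1 - a^* *: s2) (a *: s1 + b *: s2) r ->
  exists (phi phip : 'cV[C]_n) (l : C),
    [/\ is_candidate gam1 gam2 g11 g12 s1 s2 phi phip,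
        l * l^* = 1 & phip = l *: (a *: s1 + b *: s2)].
Proof.
move=> ab1 r0 r_lt1 [K1 K2 K3].
have dE u : sandwich u (gam2 - gam1) u = sandwich u gam2 u - sandwich u gam1 u.
  by rewrite sandwich_addmx sandwich_oppmx.
move: K1 K2; rewrite -scaleNr !gam1_comb !gam2_comb rmorphN /= !conjCK => K1 K2.
have {}K1 : a * b * g2 + (b ^+ 2 - a ^+ 2) * g23 = r * (a * b * g1).
  apply/eqP; rewrite -subr_eq0; move/eqP: K1; rewrite -subr_eq0.
  by congr (_ == 0); rewrite /g1 /g2; ring.
have [g23_0|g23_n0] := eqVneq g23 0.
  have [a0|a_n0] := eqVneq a 0.
    move: ab1; rewrite a0 mul0r add0r => bb.
    exists s1, s2, b^*; split; last 2 first.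
    - by rewrite conjCK mulrC.
    - by rewrite scale0r add0r scalerA mulrC bb scale1r.
    left; split=> //; left; split=> //.
    move: K3; rewrite -scaleNr dE gam1_comb gam2_comb a0 conjC0 oppr0.
    by rewrite conjC0 !mul0r !mulr0 !addr0 !mul0r !addr0 conjCK bb !mul1r subr_ge0.
  have [b0|b_n0] := eqVneq b 0.
    move: ab1; rewrite b0 mul0r addr0 => aa.
    exists s2, s1, a^*; split; last 2 first.
    - by rewrite conjCK mulrC.
    - by rewrite scale0r addr0 scalerA mulrC aa scale1r.
    left; split=> //; right; split=> //.
    move: K3; rewrite -scaleNr dE gam1_comb gam2_comb b0 conjC0 rmorphN /= conjCK.
    by rewrite conjC0 !mul0r !mulr0 !add0r !mul0r !add0r mulrNN aa !mul1r subr_ge0.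
  (* If [g23 = 0], a basis other than the eigenbasis would need [g2 = r g1]. With the diagonal
     equation this makes [<phi|gam2 - gam1|phi>] minus the two positive terms added below,
     contradicting [K3]. *)
  exfalso.
  have ab_n0 : a * b != 0 by rewrite mulf_neq0.
  have g2E : g2 = r * g1.
    apply: (mulfI ab_n0); move: K1; rewrite g23_0 mulr0 addr0 => ->.
    by rewrite mulrCA.
  have aa_gt0 : 0 < a * a^* by rewrite -normCK exprn_gt0 // normr_gt0.
  have bb_gt0 : 0 < b * b^* by rewrite -normCK exprn_gt0 // normr_gt0.
  move: K3; rewrite -scaleNr dE gam1_comb gam2_comb rmorphN /= !conjCK.
  set K3v := (X in 0 <= X) => K3.
  have d_gt0 : 0 < 1 - r by rewrite subr_gt0.
  have : 0 < K3v + (1 - r) * ((b * b^*) * g11 + (a * a^*) * g12)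
           + r * (1 - r) * ((a * a^*) * g11 + (b * b^*) * g12).
    have pos (u v : C) : 0 < u -> 0 < v -> 0 < u * g11 + v * g12.
      by move=> u0 v0; apply: addr_gt0; apply: mulr_gt0.
    apply: ltr_wpDl; last by apply: mulr_gt0; [exact: mulr_gt0 | exact: pos].
    by apply: addr_ge0 => //; apply/ltW/mulr_gt0 => //; exact: pos.
  suff -> : K3v + (1 - r) * ((b * b^*) * g11 + (a * a^*) * g12)
           + r * (1 - r) * ((a * a^*) * g11 + (b * b^*) * g12) = 0 by rewrite ltxx.
  have h21 : g21 = r * (g11 - g12) + g22 by rewrite -[g11 - g12]/g1 -g2E subrK.
  have h22 : g22 = (r ^+ 2 * ((a * a^*) * g11 + (b * b^*) * g12)
                     - r * (a * a^*) * (g11 - g12)) * 1.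
    rewrite mulr1 -[g22]mul1r -ab1.
    apply/eqP; rewrite -subr_eq0; move/eqP: K2; rewrite -subr_eq0.
    by congr (_ == 0); rewrite h21 g23_0; ring.
  have h : K3v + (1 - r) * ((b * b^*) * g11 + (a * a^*) * g12)
           + r * (1 - r) * ((a * a^*) * g11 + (b * b^*) * g12)
    = (b * b^* + a * a^*) * g22 + r * (b * b^*) * (g11 - g12)
      - r * ((b * b^*) * g11 + (a * a^*) * g12)
      + r * (1 - r) * ((a * a^*) * g11 + (b * b^*) * g12).
    by rewrite /K3v h21 g23_0; ring.
  rewrite h [b * _ + _]addrC ab1 mul1r h22.
  have -> : b * b^* = 1 - a * a^* by rewrite -ab1 addrAC subrr add0r.
  by ring.
have b_n0 : b != 0.
  apply/eqP => b0; move/eqP: K1; rewrite b0 mulr0 !mul0r mulr0 add0r expr0n sub0r mulNr oppr_eq0.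
  rewrite mulf_eq0 (negPf g23_n0) orbF expf_eq0 /= => /eqP a0.
  by move/eqP: ab1; rewrite a0 b0 !mul0r addr0 eq_sym oner_eq0.
have a_n0 : a != 0.
  apply/eqP => a0; move/eqP: K1; rewrite a0 !mul0r mulr0 add0r expr0n subr0.
  by rewrite mulf_eq0 (negPf g23_n0) orbF expf_eq0 /= (negPf b_n0).
(* The choice makes [a s1 + b s2] proportional to [x s1 - s2]. *)
pose x := - (a / b).
have x_n0 : x != 0 by rewrite oppr_eq0 mulf_neq0 ?invr_eq0.
have aE : a = - (x * b) by rewrite /x mulNr opprK divfK.
have K1x : x * g2 + (x ^+ 2 - 1) * g23 = r * (x * g1).
  have bb : - b ^+ 2 != 0 by rewrite oppr_eq0 expf_neq0.
  apply: (mulfI bb); apply/eqP; rewrite -subr_eq0; move/eqP: K1; rewrite -subr_eq0.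
  by congr (_ == 0); rewrite aE; ring.
have xC : x^* = x.
  have r_conj : r^* = r by rewrite geC0_conj // ltW.
  have g1_conj : g1^* = g1 by exact/CrealP.
  have g2_conj : g2^* = g2 by exact/CrealP.
  have conjE (y c d e f : C) : (y * c + (y ^+ 2 - 1) * d = e * (y * f)) ->
      y^* * c^* + (y^* ^+ 2 - 1) * d^* = e^* * (y^* * f^*).
    move/(congr1 Num.conj).
    by rewrite !(rmorphD, rmorphM, rmorphN, rmorphXn, rmorph1).
  have := conjE _ _ _ _ _ K1x; rewrite g1_conj g2_conj g23_conj r_conj => K1y.
  have : g23 * (x - x^*) * (1 + x * x^*) = 0.
    move/eqP: K1x; rewrite -subr_eq0 => /eqP K1x.
    move/eqP: K1y; rewrite -subr_eq0 => /eqP K1y.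
    transitivity (x^* * (x * g2 + (x ^+ 2 - 1) * g23 - r * (x * g1))
      - x * (x^* * g2 + (x^* ^+ 2 - 1) * g23 - r * (x^* * g1))); first by ring.
    by rewrite K1x K1y !mulr0 subr0.
  move/eqP; rewrite !mulf_eq0 (negPf g23_n0) /= => /orP[|/eqP h].
    by rewrite subr_eq0 => /eqP <-.
  have : 0 < 1 + x * x^* by rewrite ltr_wpDr // -normCK exprn_ge0.
  by rewrite h ltxx.
have xR : x \is Num.real by apply/CrealP.
have [k k0 [k2 kE]] := norm1x xR.
have kR : k^* = k by rewrite geC0_conj // ltW.
have bbx : b * b^* * (1 + x ^+ 2) = 1.
  by rewrite -[RHS]ab1 aE rmorphN rmorphM /= xC; ring.
have bj_n0 : b^* != 0 by rewrite conjC_eq0.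
exists (phi_of s1 s2 x), (phiperp_of s1 s2 x), (- (k / b)).
have x1_n0 : 1 + x ^+ 2 != 0.
  by apply: contra_eq_neq k2 => ->; rewrite mulr0 eq_sym oner_neq0.
split; last 2 first.
- rewrite rmorphN rmorphM fmorphV /= kR mulrNN.
  apply: (mulIf x1_n0); rewrite mul1r.
  have bbx' : 1 + x ^+ 2 = (b * b^*)^-1.
    by apply: (mulfI (mulf_neq0 b_n0 bj_n0)); rewrite bbx mulfV // mulf_neq0.
  have -> : k / b * (k / b^*) * (1 + x ^+ 2) = k ^+ 2 * (1 + x ^+ 2) * (b * b^*)^-1.
    by rewrite invfM; ring.
  by rewrite k2 mul1r.
- rewrite (phiperp_ofE kE) scalerDr !scalerA aE; congr (_ *: _ + _ *: _); field; exact: b_n0.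
right; split; first exact/eqP.
exists x; split=> //; first exact/eqP.
(* After substitution of [K1x], the polynomial times [|b|^2] is [x^2 g1^2] times the diagonal
   equation [K2]. *)
- rewrite -/g21 -/g22 -/g23 -/g1 -/g2 K1x.
  have bb_n0 := mulf_neq0 b_n0 bj_n0.
  apply: (mulfI bb_n0); rewrite mulr0.
  move/eqP: K2; rewrite -subr_eq0 => /eqP K2.
  transitivity (x ^+ 2 * g1 ^+ 2 * 0); last by rewrite mulr0.
  by rewrite -K2 aE rmorphN rmorphM /= xC; ring.
- rewrite -/g21 -/g22 -/g23 -/g1 -/g2 [g23 * _]mulrC K1x mulrCA -expr2.
  by rewrite mulr_ge0 ?(ltW r0) // -realEsqr rpredM.
split=> //.
have -> : phi_of s1 s2 x = (k / b^*) *: (b^* *: s1 - a^* *: s2).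
  rewrite (phi_ofE kE) scalerBr !scalerA -scaleNr aE rmorphN rmorphM /= xC.
  by congr (_ *: _ + _ *: _); field; exact: bj_n0.
rewrite /sandwich -scalemxAr braketZr braketZl mulrA.
by rewrite mulr_ge0 // -normCK exprn_ge0.
Qed.

(** Proportionality excludes mixing [s1] with [s2]; otherwise [x] is the quotient of the two
    coordinates of [phi], which no scaling changes. *)
Lemma candidate_uniq (phi phip phi' phip' : 'cV[C]_n) (c : C) :
  is_candidate gam1 gam2 g11 g12 s1 s2 phi phip ->
  is_candidate gam1 gam2 g11 g12 s1 s2 phi' phip' ->
  phi = c *: phi' -> phi = phi' /\ phip = phip'.
Proof.
have s12_neq d : s1 = d *: s2 -> False.
  move=> /(congr1 (braket s1)); rewrite braketZr s11 s12 mulr0 => /eqP.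
  by rewrite oner_eq0.
have s21_neq d : s2 = d *: s1 -> False.
  move=> /(congr1 (braket s2)); rewrite braketZr s22 s21 mulr0 => /eqP.
  by rewrite oner_eq0.
case=> [[e [[_ [-> ->]]|[_ [-> ->]]]]|[e ex]];
  case=> [[e' [[_ [-> ->]]|[_ [-> ->]]]]|[e' ex']] //.
- by move=> /s12_neq.
- by move=> /s21_neq.
move: ex ex' => [x [xR _ _ _ [_ -> ->]]] [x' [x'R _ _ _ [_ -> ->]]] xx'.
suff <- : x = x' by [].
have [k k0 [_ kE]] := norm1x xR; have [k' k'0 [_ kE']] := norm1x x'R.
rewrite (phi_ofE kE) (phi_ofE kE') in xx'.
have := congr1 (braket s1) xx'; have := congr1 (braket s2) xx'.
rewrite !(braketDr, braketZr) s11 s12 s21 s22 !mulr0 !mulr1 !addr0 !add0r.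
move=> kx kk; rewrite kk -mulrA in kx.
have ck' : c * k' != 0 by rewrite -kk lt0r_neq0.
by apply: (mulfI ck'); rewrite -mulrA kx mulrA.
Qed.

End Candidates.

(** * Correspondence between good candidates and optimal measurements of ranks 1 and 2 *)

Theorem mainTheorem6 (R : realType) (gam1 gam2 : 'M[R[i]]_4)
    (g11 g12 : R[i]) (s1 s2 : 'cV[R[i]]_4)
    (psd1 : psd gam1) (psd2 : psd gam2)
    (supp_supp : supp gam1 `&` supp gam2 = [set 0])
    (ker_ker : ker gam1 `&` ker gam2 = [set 0])
    (supp_ker : supp gam1 `&` ker gam2 = [set 0])
    (ker_supp : ker gam1 `&` supp gam2 = [set 0])
    (s_basis : orthonormal_basis2 (supp gam1) s1 s2)
    (eig1 : gam1 *m s1 = g11 *: s1) (eig2 : gam1 *m s2 = g12 *: s2)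
    (g11_ge_g12 : g12 <= g11) (g12_gt0 : 0 < g12)
    (g23_ge0 : 0 <= sandwich s1 gam2 s2)
    (g23_eq0 : g11 - g12 = 0 -> sandwich s1 gam2 s2 = 0) :
  let good (phi phip : 'cV[R[i]]_4) : Prop :=
    is_candidate gam1 gam2 g11 g12 s1 s2 phi phip /\
    braket (ntilde gam1 gam2 phip) (ntilde gam1 gam2 phip) < 1 in
  (forall phi phip phi' phip' : 'cV[R[i]]_4,
     good phi phip -> good phi' phip' -> phi = phi' /\ phip = phip')
  /\
  (forall E1 E2 Eq : 'M[R[i]]_4, is_optimal_USD gam1 gam2 E1 E2 Eq ->
     ((\rank E1 = 1%N /\ \rank E2 = 2%N) <->
        exists phi phip : 'cV[R[i]]_4, good phi phip)
     /\
     (forall phi phip : 'cV[R[i]]_4, good phi phip ->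
        Eq = ketbra (ntilde gam1 gam2 phip) (ntilde gam1 gam2 phip)
             + ketbra phi phi)).
Proof.
move=> good.
have goodP phi phip : good phi phip ->
    [/\ orthonormal_basis2 (supp gam1) phi phip,
        0 < Defs.ratio gam1 gam2 phip,
        stationary gam1 gam2 phi phip (Defs.ratio gam1 gam2 phip) &
        braket ((sqrtC (Defs.ratio gam1 gam2 phip))^-1 *:
                (phip - (1 - Defs.ratio gam1 gam2 phip) *: oblique gam1 gam2 phip))
               ((sqrtC (Defs.ratio gam1 gam2 phip))^-1 *:
                (phip - (1 - Defs.ratio gam1 gam2 phip) *: oblique gam1 gam2 phip)) < 1].
  case=> cand nt1.
  have [phiB stat] := candidate_stationary psd1 psd2 supp_ker s_basis eig1 eig2
    g11_ge_g12 g12_gt0 g23_ge0 cand.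
  have [sv v0] := orthonormal_basis_mem phiB; split=> //; first exact: ratio_gt0.
  by rewrite -ntildeE.
split=> [phi phip phi' phip' gd gd'|E1 E2 Eq opt].
  have [phiB r0 st nt1] := goodP _ _ gd; have [phiB' r0' st' nt1'] := goodP _ _ gd'.
  (* The measurement built from the first candidate is optimal, hence equal to the one built from
     the second. The kernel of its first operator within [supp gam1] then makes [phi] and [phi']
     proportional. *)
  have opt := stationary_is_optimal psd1 psd2 supp_supp ker_ker phiB r0 st nt1.
  have [e1 _ _] := stationary_optimal_uniq psd1 psd2 supp_supp ker_ker supp_ker
    phiB' r0' st' nt1' opt.
  have [[c1 _] [c2 _]] := (gd, gd').
  have [c phiE] : exists c, phi = c *: phi'.
    apply: (USD1_ker psd1 psd2 supp_supp ker_ker phiB' r0' nt1').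
      by case: phiB => _ _ _ ->; exists 1, 0; rewrite scale1r scale0r addr0.
    by rewrite -e1; exact: USD1_phi phiB.
  exact: (candidate_uniq s_basis c1 c2 phiE).
split.
  split=> [[rE1 rE2]|[phi [phip gd]]].
    have [|a [b [r [ab1 r0 r1 st zz]]]] := optimal_rank_stationary psd1 psd2
      supp_supp ker_ker supp_ker s_basis opt rE1; first by rewrite rE2.
    have [phi [phip [l [cand ll phipE]]]] := stationary_candidate psd2
      s_basis eig1 eig2 g11_ge_g12 g12_gt0 g23_ge0 ab1 r0 r1 st.
    exists phi, phip; split=> //.
    have [phiB [_ K2 _]] := candidate_stationary psd1 psd2 supp_ker s_basis eig1 eig2
      g11_ge_g12 g12_gt0 g23_ge0 cand.
    have [sv v0] := orthonormal_basis_mem phiB.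
    (* The phase [l] leaves expectations unchanged, so the ratio of the candidate is the [r] found
       from optimality and the norm bound carries over. *)
    have scale A : sandwich phip A phip =
        sandwich (a *: s1 + b *: s2) A (a *: s1 + b *: s2).
      by rewrite phipE /sandwich -scalemxAr braketZl braketZr mulrA [l^* * _]mulrC ll mul1r.
    have rE : Defs.ratio gam1 gam2 phip = r.
      by apply: ratio_uniq => //; rewrite !scale; case: st.
    rewrite (ntilde_lt1 psd1 psd2 ker_ker supp_ker sv v0 rE).
    have -> : phip - (1 - r) *: oblique gam1 gam2 phip = l *: (a *: s1 + b *: s2 -
        (1 - r) *: oblique gam1 gam2 (a *: s1 + b *: s2)).
      by rewrite phipE obliqueZ scalerBr !scalerA [l * _]mulrC.
    by rewrite braketZl braketZr mulrA [l^* * _]mulrC ll mul1r.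
  have [phiB r0 st nt1] := goodP _ _ gd.
  have [-> -> _] := stationary_optimal_uniq psd1 psd2 supp_supp ker_ker supp_ker
    phiB r0 st nt1 opt.
  split; first exact: (stationary_rank1 psd1 psd2 supp_supp ker_ker phiB r0 nt1).
  apply/eqP; rewrite -(eqn_add2r 2); apply/eqP.
  exact: (stationary_rank2 psd1 psd2 supp_supp ker_ker phiB r0 nt1).
move=> phi phip gd; have [phiB r0 st nt1] := goodP _ _ gd.
have [_ _ ->] := stationary_optimal_uniq psd1 psd2 supp_supp ker_ker supp_ker
    phiB r0 st nt1 opt.
have [sv v0] := orthonormal_basis_mem phiB.
by rewrite /USDq -ntildeE.
Qed.
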